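(* Let $\mathcal{Q}$ be a small quantaloid that is completely distributive, i.e. every hom lattice $\mathcal{Q}(p,q)$ is a completely distributive lattice. Then $\mathcal{H}\mathcal{H}^\dagger$ belongs to a sub-2-monad $(\mathcal{H}\mathcal{H}^\dagger,\mathfrak{s},\mathfrak{y})$ of the double presheaf 2-monad $(\mathcal{P}\mathcal{P}^\dagger,\mathfrak{s},\mathfrak{y})$ on $\mathcal{Q}\text{-}\mathbf{Cat}$, and it admits the flat lax extension $\overline{\mathcal{H}\mathcal{H}^\dagger}$ to $\mathcal{Q}\text{-}\mathbf{Dist}$, with $\overline{\mathcal{H}\mathcal{H}^\dagger}=\overline{\mathcal{H}}\,\overline{\mathcal{H}^\dagger}$. Likewise, there is a 2-monad $(\mathcal{H}^\dagger\mathcal{H},\mathfrak{s}^\dagger,\mathfrak{y}^\dagger)$ on $\mathcal{Q}\text{-}\mathbf{Cat}$ admitting the flat lax extension $\overline{\mathcal{H}^\dagger\mathcal{H}}$ to $\mathcal{Q}\text{-}\mathbf{Dist}$, with $\overline{\mathcal{H}^\dagger\mathcal{H}}=\overline{\mathcal{H}^\dagger}\,\overline{\mathcal{H}}$.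
   Context: A quantaloid $\mathcal{Q}$ is a category whose hom-sets are complete lattices such that composition preserves arbitrary suprema in each variable; $\mathcal{Q}_0=\mathrm{ob}\,\mathcal{Q}$. For $\alpha:p\to q,\beta:q\to r,\gamma:p\to r$: $\alpha\le\beta\searrow\gamma\iff\beta\circ\alpha\le\gamma\iff\beta\le\gamma\swarrow\alpha$; the same notation is used in $\mathcal{Q}\text{-}\mathbf{Dist}$ below. A $\mathcal{Q}$-relation $r:X\nrightarrow Y$ between sets over $\mathcal{Q}_0$ (sets with a type map $|\cdot|$ to $\mathcal{Q}_0$) is a family of morphisms $r(x,y):|x|\to|y|$ in $\mathcal{Q}$; $(s\circ r)(x,z)=\bigvee_y s(y,z)\circ r(x,y)$; the identity is $1_X^\circ$ with $1_X^\circ(x,x)=1_{|x|}$ and $1_X^\circ(x,y)=\bot$ for $x\ne y$; order pointwise. A $\mathcal{Q}$-category is $(X,a)$ with $a:X\nrightarrow X$, $1_X^\circ\le a$, $a\circ a\le a$. A $\mathcal{Q}$-functor $f:(X,a)\to(Y,b)$ is a type-preserving map with $a(x,x')\le b(fx,fx')$ (fully faithful if equality always holds); $f\le g$ iff $1_{|x|}\le b(fx,gx)$ for all $x$. This gives the 2-category $\mathcal{Q}\text{-}\mathbf{Cat}$; 2-functors are functors monotone on homs; a 2-monad is a monad whose endofunctor is a 2-functor. A $\mathcal{Q}$-distributor $\varphi:(X,a)\nrightarrow(Y,b)$ is a $\mathcal{Q}$-relation with $b\circ\varphi\circ a\le\varphi$; these form the quantaloid $\mathcal{Q}\text{-}\mathbf{Dist}$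 with composition and order as for $\mathcal{Q}$-relations and identity $1^*_{(X,a)}=a$. For a $\mathcal{Q}$-functor $f:(X,a)\to(Y,b)$: $f_*(x,y)=b(fx,y)$, $f^*(y,x)=b(y,fx)$. $\{s\}$ is the one-object $\mathcal{Q}$-category of type $s$ with hom $1_s$. $\mathcal{P}X$ consists of presheaves $\sigma:X\nrightarrow\{s\}$ ($s\in\mathcal{Q}_0$), $|\sigma|=s$, with hom $1^*_{\mathcal{P}X}(\sigma,\tau)=\tau\swarrow\sigma$; $\mathcal{P}^\dagger X$ consists of copresheaves $\sigma:\{s\}\nrightarrow X$, $|\sigma|=s$, with hom $1^*_{\mathcal{P}^\dagger X}(\sigma,\tau)=\tau\searrow\sigma$. On a $\mathcal{Q}$-functor $f:X\to Y$: $\mathcal{P}f(\sigma)=\sigma\circ f^*$, $\mathcal{P}^\dagger f(\tau)=f_*\circ\tau$. Yoneda and co-Yoneda functors: $\mathsf{y}_X:X\to\mathcal{P}X$, $x\mapsto a(-,x)$; $\mathsf{y}^\dagger_X:X\to\mathcal{P}^\dagger X$, $x\mapsto a(x,-)$. The double presheaf 2-monad $(\mathcal{P}\mathcal{P}^\dagger,\mathfrak{s},\mathfrak{y})$ has $\mathfrak{y}_X=\mathsf{y}_{\mathcal{P}^\dagger X}\cdot\mathsf{y}^\dagger_X$ and $\mathfrak{s}_X:\mathcal{P}\mathcal{P}^\dagger\mathcal{P}\mathcal{P}^\dagger X\to\mathcal{P}\mathcal{P}^\dagger X$, $\Upsilon\mapsto\Upsilon\circ(\mathsf{y}^\dagger_{\mathcal{P}\mathcal{P}^\dagger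 X}\cdot\mathsf{y}_{\mathcal{P}^\dagger X})_*$. A presheaf $\sigma$ on $(X,a)$ is conical if $\sigma=\bigvee_{x\in A}a(-,x)$ for some $A\subseteq X$ with $|x|=|\sigma|$ for all $x\in A$; a copresheaf $\tau$ is conical if $\tau=\bigvee_{x\in A}a(x,-)$ for some $A\subseteq X$ with $|x|=|\tau|$ for all $x\in A$. $\mathcal{H}X\subseteq\mathcal{P}X$ and $\mathcal{H}^\dagger X\subseteq\mathcal{P}^\dagger X$ are the full sub-$\mathcal{Q}$-categories of conical presheaves, resp. conical copresheaves; $\mathcal{H}$ and $\mathcal{H}^\dagger$ are 2-functors by restricting $\mathcal{P}f$ and $\mathcal{P}^\dagger f$, and $\mathsf{y}_X$, $\mathsf{y}^\dagger_X$ take values in $\mathcal{H}X$, $\mathcal{H}^\dagger X$. The structure of $(\mathcal{H}\mathcal{H}^\dagger,\mathfrak{s},\mathfrak{y})$ is $\mathfrak{y}_X=\mathsf{y}_{\mathcal{H}^\dagger X}\cdot\mathsf{y}^\dagger_X:X\to\mathcal{H}\mathcal{H}^\dagger X$ and $\mathfrak{s}_X:\mathcal{H}\mathcal{H}^\dagger\mathcal{H}\mathcal{H}^\dagger X\to\mathcal{H}\mathcal{H}^\dagger X$, $\Upsilon\mapsto\Upsilon\circ(\mathsf{y}^\dagger_{\mathcal{H}\mathcal{H}^\dagger X}\cdot\mathsf{y}_{\mathcal{H}^\dagger X})_*$; ''sub-2-monad'' means that the natural fully faithful embeddings $\mathcal{H}\mathcal{H}^\dagger X\to\mathcal{P}\mathcal{P}^\dagger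 X$, $\Sigma\mapsto\Sigma\circ i_X^*$ (with $i_X:\mathcal{H}^\dagger X\hookrightarrow\mathcal{P}^\dagger X$ the inclusion) form a monad morphism. The structure of $(\mathcal{H}^\dagger\mathcal{H},\mathfrak{s}^\dagger,\mathfrak{y}^\dagger)$ is $\mathfrak{y}^\dagger_X=\mathsf{y}^\dagger_{\mathcal{H}X}\cdot\mathsf{y}_X$ and $\mathfrak{s}^\dagger_X:\mathcal{H}^\dagger\mathcal{H}\mathcal{H}^\dagger\mathcal{H}X\to\mathcal{H}^\dagger\mathcal{H}X$, $\Theta\mapsto(\mathsf{y}_{\mathcal{H}^\dagger\mathcal{H}X}\cdot\mathsf{y}^\dagger_{\mathcal{H}X})^*\circ\Theta$. For any 2-functor $\mathcal{T}$ on $\mathcal{Q}\text{-}\mathbf{Cat}$, $\overline{\mathcal{T}}X=\mathcal{T}X$ and $\overline{\mathcal{T}}\varphi:=(\mathcal{T}\overleftarrow{\varphi})^*\circ(\mathcal{T}\mathsf{y}_X)_*$ for $\varphi:X\nrightarrow Y$, where $\mathsf{y}_X:X\to\mathcal{P}X$ and $\overleftarrow{\varphi}:Y\to\mathcal{P}X$, $y\mapsto\varphi(-,y)$. A lax extension of a 2-monad $(\mathcal{T},\mathsf{m},\mathsf{e})$ to $\mathcal{Q}\text{-}\mathbf{Dist}$ is a lax 2-functor $\hat{\mathcal{T}}$ on $\mathcal{Q}\text{-}\mathbf{Dist}$ (monotone on homs, $1^*\le\hat{\mathcal{T}}1^*$, $\hat{\mathcal{T}}\psi\circ\hat{\mathcal{T}}\varphi\le\hat{\mathcal{T}}(\psi\circ\varphi)$)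 agreeing with $\mathcal{T}$ on objects, with $(\mathcal{T}f)_*\le\hat{\mathcal{T}}(f_* )$, $(\mathcal{T}f)^*\le\hat{\mathcal{T}}(f^* )$ for all $\mathcal{Q}$-functors $f$, and $(\mathsf{m}_Y)_*\circ\hat{\mathcal{T}}\hat{\mathcal{T}}\varphi\le\hat{\mathcal{T}}\varphi\circ(\mathsf{m}_X)_*$, $(\mathsf{e}_Y)_*\circ\varphi\le\hat{\mathcal{T}}\varphi\circ(\mathsf{e}_X)_*$ for all $\varphi:X\nrightarrow Y$; it is flat if $(\mathcal{T}f)_*=\hat{\mathcal{T}}(f_* )$ and $(\mathcal{T}f)^*=\hat{\mathcal{T}}(f^* )$ for all $f$. *)

(* Defs.v *)
(* With functional extensionality and proof irrelevance, Leibniz equality of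
   Q-functors and of Q-distributors is pointwise equality. *)
From Stdlib Require Import ssreflect.
From Stdlib Require Import FunctionalExtensionality ProofIrrelevance.

Set Implicit Arguments.
Unset Strict Implicit.
Unset Printing Implicit Defensive.

Declare Scope quantaloid_scope.
Delimit Scope quantaloid_scope with Q.
Local Open Scope quantaloid_scope.

Reserved Notation "x ⊑ y" (at level 70, no associativity).
Reserved Notation "b ∘ a" (at level 40, left associativity).
Reserved Notation "c ↙ a" (at level 45, no associativity).
Reserved Notation "b ↘ c" (at level 45, no associativity).
Reserved Notation "s ⊙ r" (at level 40, left associativity).
Reserved Notation "t ⇙ s" (at level 45, no associativity).
Reserved Notation "t ⇘ s" (at level 45, no associativity).
Reserved Notation "g ⋅ f" (at level 40, left associativity).

Record CompleteLattice : Type := {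
  cl_car :> Type;
  cl_le : cl_car -> cl_car -> Prop;
  cl_sup : (cl_car -> Prop) -> cl_car;
  cl_le_refl : forall x, cl_le x x;
  cl_le_trans : forall x y z, cl_le x y -> cl_le y z -> cl_le x z;
  cl_le_antisym : forall x y, cl_le x y -> cl_le y x -> x = y;
  cl_sup_ub : forall (A : cl_car -> Prop) x, A x -> cl_le x (cl_sup A);
  cl_sup_least : forall (A : cl_car -> Prop) y,
    (forall x, A x -> cl_le x y) -> cl_le (cl_sup A) y }.

Arguments cl_le {_} _ _.
Arguments cl_sup {_} _.
Notation "x ⊑ y" := (cl_le x y) : quantaloid_scope.

Definition cl_inf (L : CompleteLattice) (A : L -> Prop) : L :=
  cl_sup (fun y => forall x, A x -> y ⊑ x).

Definition isup (L : CompleteLattice) (I : Type) (f : I -> L) : L :=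
  cl_sup (fun u => exists i, u = f i).
Definition iinf (L : CompleteLattice) (I : Type) (f : I -> L) : L :=
  cl_inf (fun u => exists i, u = f i).

Definition completely_distributive_lattice (L : CompleteLattice) : Prop :=
  forall (I : Type) (J : I -> Type) (x : forall i, J i -> L),
    iinf (fun i => isup (x i)) =
    isup (fun c : forall i, J i => iinf (fun i => x i (c i))).

Record Quantaloid : Type := {
  ob :> Type;
  hom : ob -> ob -> CompleteLattice;
  idm : forall p, hom p p;
  comp : forall p q r, hom q r -> hom p q -> hom p r;
  comp_assoc : forall p q r s (c : hom r s) (b : hom q r) (a : hom p q),
    comp c (comp b a) = comp (comp c b) a;
  comp_idl : forall p q (a : hom p q), comp (idm q) a = a;
  comp_idr : forall p q (a : hom p q), comp a (idm p) = a;
  comp_supr : forall p q r (b : hom q r) (A : hom p q -> Prop),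
    comp b (cl_sup A) = cl_sup (fun u => exists a, A a /\ u = comp b a);
  comp_supl : forall p q r (B : hom q r -> Prop) (a : hom p q),
    comp (cl_sup B) a = cl_sup (fun u => exists b, B b /\ u = comp b a) }.

Arguments hom {_} _ _.
Arguments idm {_} _.
Arguments comp {_ p q r} _ _.
Notation "b ∘ a" := (comp b a) : quantaloid_scope.

Definition completely_distributive (Q : Quantaloid) : Prop :=
  forall p q : Q, completely_distributive_lattice (hom p q).

Definition swarrow (Q : Quantaloid) (p q r : Q) (c : hom p r) (a : hom p q) :
  hom q r := cl_sup (fun b => b ∘ a ⊑ c).
Definition searrow (Q : Quantaloid) (p q r : Q) (b : hom q r) (c : hom p r) :
  hom p q := cl_sup (fun a => b ∘ a ⊑ c).
Notation "c ↙ a" := (swarrow c a) : quantaloid_scope.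
Notation "b ↘ c" := (searrow b c) : quantaloid_scope.

Section LatticeFacts.
Variable L : CompleteLattice.

Lemma le_of_eq (x y : L) : x = y -> x ⊑ y.
Proof. by move=> ->; apply: cl_le_refl. Qed.

Lemma cl_le_trans_r (x y z : L) : y ⊑ z -> x ⊑ y -> x ⊑ z.
Proof. by move=> H K; apply: cl_le_trans K H. Qed.

Lemma cl_inf_lb (A : L -> Prop) x : A x -> cl_inf A ⊑ x.
Proof. by move=> Ax; apply: cl_sup_least => y; apply. Qed.

Lemma cl_inf_greatest (A : L -> Prop) y :
  (forall x, A x -> y ⊑ x) -> y ⊑ cl_inf A.
Proof. by move=> H; apply: (@cl_sup_ub _ (fun _ => _)). Qed.
End LatticeFacts.

Section QuantaloidFacts.
Variable Q : Quantaloid.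

Lemma comp_sup_ler (p q r : Q) (b : hom q r) (A : hom p q -> Prop) c :
  (forall a, A a -> b ∘ a ⊑ c) -> b ∘ cl_sup A ⊑ c.
Proof.
by move=> H; rewrite comp_supr; apply: cl_sup_least => _ [a [Aa ->]]; apply: H.
Qed.

Lemma comp_sup_lel (p q r : Q) (B : hom q r -> Prop) (a : hom p q) c :
  (forall b, B b -> b ∘ a ⊑ c) -> cl_sup B ∘ a ⊑ c.
Proof.
by move=> H; rewrite comp_supl; apply: cl_sup_least => _ [b [Bb ->]]; apply: H.
Qed.

Lemma sup_pair (L : CompleteLattice) (x y : L) :
  x ⊑ y -> cl_sup (fun u => u = x \/ u = y) = y.
Proof.
move=> H; apply: cl_le_antisym; last by apply: cl_sup_ub; right.
by apply: cl_sup_least => u [->|->] //; apply: cl_le_refl.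
Qed.

Lemma comp_mono (p q r : Q) (b b' : hom q r) (a a' : hom p q) :
  b ⊑ b' -> a ⊑ a' -> b ∘ a ⊑ b' ∘ a'.
Proof.
move=> Hb Ha; apply: (@cl_le_trans _ _ (b' ∘ a)).
  rewrite -(sup_pair Hb) comp_supl; apply: cl_sup_ub.
  by exists b; split; [left|].
rewrite -(sup_pair Ha) comp_supr; apply: cl_sup_ub.
by exists a; split; [left|].
Qed.

Lemma comp_monol (p q r : Q) (b b' : hom q r) (a : hom p q) :
  b ⊑ b' -> b ∘ a ⊑ b' ∘ a.
Proof. by move=> H; apply: comp_mono H (cl_le_refl _). Qed.

Lemma comp_monor (p q r : Q) (b : hom q r) (a a' : hom p q) :
  a ⊑ a' -> b ∘ a ⊑ b ∘ a'.
Proof. exact: comp_mono (cl_le_refl _). Qed.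

Lemma swarrowP (p q r : Q) (c : hom p r) (a : hom p q) (b : hom q r) :
  b ∘ a ⊑ c <-> b ⊑ c ↙ a.
Proof.
split=> H; first exact: (@cl_sup_ub _ (fun _ => _)).
apply: (cl_le_trans (comp_mono H (cl_le_refl a)) _).
exact: comp_sup_lel.
Qed.

Lemma searrowP (p q r : Q) (c : hom p r) (b : hom q r) (a : hom p q) :
  b ∘ a ⊑ c <-> a ⊑ b ↘ c.
Proof.
split=> H; first exact: (@cl_sup_ub _ (fun _ => _)).
apply: (cl_le_trans (comp_mono (cl_le_refl b) H) _).
exact: comp_sup_ler.
Qed.

Lemma swarrow_intro (p q r : Q) (c : hom p r) (a : hom p q) (b : hom q r) :
  b ∘ a ⊑ c -> b ⊑ c ↙ a.
Proof. by case: (swarrowP c a b). Qed.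

Lemma swarrow_elim (p q r : Q) (c : hom p r) (a : hom p q) (b : hom q r) :
  b ⊑ c ↙ a -> b ∘ a ⊑ c.
Proof. by case: (swarrowP c a b). Qed.

Lemma searrow_intro (p q r : Q) (c : hom p r) (b : hom q r) (a : hom p q) :
  b ∘ a ⊑ c -> a ⊑ b ↘ c.
Proof. by case: (searrowP c b a). Qed.

Lemma searrow_elim (p q r : Q) (c : hom p r) (b : hom q r) (a : hom p q) :
  a ⊑ b ↘ c -> b ∘ a ⊑ c.
Proof. by case: (searrowP c b a). Qed.
End QuantaloidFacts.

Arguments comp_monol {Q p q r b b' a} _.
Arguments comp_monor {Q p q r b a a'} _.

Section QCategories.
Variable Q : Quantaloid.

(* A set X with a type map |.| : X -> Q_0 is given by its fibres: X q is the
   set of the elements of type q.  Type-preserving maps are then families of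
   maps between fibres. *)
Local Notation QSet := (Q -> Type).

Definition QRel (X Y : QSet) : Type := forall p q, X p -> Y q -> hom p q.

Definition rel_le (X Y : QSet) (r s : QRel X Y) : Prop :=
  forall p q (x : X p) (y : Y q), r p q x y ⊑ s p q x y.

Definition rel_comp (X Y Z : QSet) (s : QRel Y Z) (r : QRel X Y) : QRel X Z :=
  fun p t x z =>
    cl_sup (fun u => exists q (y : Y q), u = s q t y z ∘ r p q x y).

(* rel_id_val x y u holds iff x = y and u is the identity of |x|; the supremum
   of these u is the identity if x = y, and bottom otherwise. *)
Inductive rel_id_val (X : QSet) (p : Q) (x : X p) :
    forall q, X q -> hom p q -> Prop :=
  rel_id_val_refl : rel_id_val x x (idm p).

Definition rel_id (X : QSet) : QRel X X :=
  fun p q x y => cl_sup (rel_id_val x (q := q) y).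

Record QCat : Type := {
  qcar :> QSet;
  qhom : QRel qcar qcar;
  qcat_refl : rel_le (rel_id (X := qcar)) qhom;
  qcat_trans : rel_le (rel_comp qhom qhom) qhom }.

Arguments qhom X {p q} _ _ : rename.

Record QFun (X Y : QCat) : Type := {
  qmap :> forall q, X q -> Y q;
  qmap_hom : forall p q (x : X p) (x' : X q),
    qhom X x x' ⊑ qhom Y (qmap x) (qmap x') }.

Definition fully_faithful (X Y : QCat) (f : QFun X Y) : Prop :=
  forall p q (x : X p) (x' : X q), qhom X x x' = qhom Y (f _ x) (f _ x').

Definition qfun_le (X Y : QCat) (f g : QFun X Y) : Prop :=
  forall q (x : X q), idm q ⊑ qhom Y (f q x) (g q x).

Record Dist (X Y : QCat) : Type := {
  drel :> forall p q, X p -> Y q -> hom p q;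
  dist_ax : rel_le (rel_comp (@qhom Y) (rel_comp drel (@qhom X))) drel }.

Definition dist_le (X Y : QCat) (phi psi : Dist X Y) : Prop := rel_le phi psi.

Lemma rel_comp_ub (X Y Z : QSet) (s : QRel Y Z) (r : QRel X Y)
    p q t (x : X p) (y : Y q) (z : Z t) :
  s q t y z ∘ r p q x y ⊑ rel_comp s r x z.
Proof. by apply: cl_sup_ub; exists q, y. Qed.

Lemma rel_comp_via (X Y Z : QSet) q (y : Y q) (s : QRel Y Z) (r : QRel X Y)
    p t (x : X p) (z : Z t) c :
  c ⊑ s q t y z ∘ r p q x y -> c ⊑ rel_comp s r x z.
Proof. by move=> H; apply: cl_le_trans H _; apply: rel_comp_ub. Qed.

Arguments rel_comp_via {X Y Z q} y {s r p t x z c} _.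

Lemma rel_comp_least (X Y Z : QSet) (s : QRel Y Z) (r : QRel X Y)
    p t (x : X p) (z : Z t) c :
  (forall q (y : Y q), s q t y z ∘ r p q x y ⊑ c) -> rel_comp s r x z ⊑ c.
Proof. by move=> H; apply: cl_sup_least => _ [q [y ->]]. Qed.

Lemma rel_comp_assoc (W X Y Z : QSet)
    (t : QRel Y Z) (s : QRel X Y) (r : QRel W X) p q (w : W p) (z : Z q) :
  rel_comp t (rel_comp s r) w z = rel_comp (rel_comp t s) r w z.
Proof.
apply: cl_le_antisym; apply: rel_comp_least.
  move=> j y; apply: comp_sup_ler => _ [i [x ->]]; rewrite comp_assoc.
  apply: (rel_comp_via x).
  by apply: comp_monol; apply: rel_comp_ub.
move=> i x; apply: comp_sup_lel => _ [j [y ->]]; rewrite -comp_assoc.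
apply: (rel_comp_via y).
by apply: comp_monor; apply: rel_comp_ub.
Qed.

Lemma qhom_refl (X : QCat) p (x : X p) : idm p ⊑ qhom X x x.
Proof.
apply: (cl_le_trans_r (qcat_refl x x)).
by apply: cl_sup_ub; constructor.
Qed.

Lemma qhom_trans (X : QCat) p q r (x : X p) (y : X q) (z : X r) :
  qhom X y z ∘ qhom X x y ⊑ qhom X x z.
Proof. by apply: (cl_le_trans_r (qcat_trans x z)); apply: rel_comp_ub. Qed.

Lemma rel_id_le (X : QSet) (r : QRel X X) :
  (forall p (x : X p), idm p ⊑ r p p x x) -> rel_le (rel_id (X := X)) r.
Proof. by move=> H p q x y; apply: cl_sup_least => u; case. Qed.

Lemma rel_comp_le (X Y Z : QSet) (s : QRel Y Z) (r : QRel X Y) (t : QRel X Z) :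
  (forall p q k (x : X p) (y : Y q) (z : Z k),
     s q k y z ∘ r p q x y ⊑ t p k x z) -> rel_le (rel_comp s r) t.
Proof. by move=> H p k x z; apply: rel_comp_least => q y. Qed.

Lemma dist_actl (X Y : QCat) (phi : Dist X Y) p q r
    (x : X p) (y : Y q) (y' : Y r) :
  qhom Y y y' ∘ phi p q x y ⊑ phi p r x y'.
Proof.
apply: (cl_le_trans_r (dist_ax phi x y')); apply: (rel_comp_via y).
apply: comp_monor; apply: (rel_comp_via x).
rewrite -{1}(comp_idr (phi p q x y)).
by apply: comp_monor; apply: qhom_refl.
Qed.

Lemma dist_actr (X Y : QCat) (phi : Dist X Y) p q r
    (x : X p) (x' : X q) (y : Y r) :
  phi q r x' y ∘ qhom X x x' ⊑ phi p r x y.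
Proof.
apply: (cl_le_trans_r (dist_ax phi x y)); apply: (rel_comp_via y).
rewrite -{1}(comp_idl (_ ∘ _)).
apply: comp_mono; [exact: qhom_refl | exact: rel_comp_ub].
Qed.

Lemma dist_axI (X Y : QCat) (r : QRel X Y) :
  (forall i j k (x : X i) (y : Y j) (y' : Y k),
     qhom Y y y' ∘ r i j x y ⊑ r i k x y') ->
  (forall i j k (x : X i) (x' : X j) (y : Y k),
     r j k x' y ∘ qhom X x x' ⊑ r i k x y) ->
  rel_le (rel_comp (@qhom Y) (rel_comp r (@qhom X))) r.
Proof.
move=> Hl Hr; apply: rel_comp_le => i k j x y y'.
apply: comp_sup_ler => _ [l [x' ->]].
apply: (cl_le_trans_r (Hl _ _ _ _ y _)).
exact: comp_monor (Hr _ _ _ _ _ _).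
Qed.

Lemma dist_ext (X Y : QCat) (phi psi : Dist X Y) :
  (forall p q (x : X p) (y : Y q), phi p q x y = psi p q x y) -> phi = psi.
Proof.
case: phi psi => [r Hr] [s Hs] /= H.
have E : r = s by do 4 (apply: functional_extensionality_dep => ?); apply: H.
by case: _ / E in Hs *; rewrite (proof_irrelevance _ Hr Hs).
Qed.

Lemma dist_le_antisym (X Y : QCat) (phi psi : Dist X Y) :
  dist_le phi psi -> dist_le psi phi -> phi = psi.
Proof. by move=> H K; apply: dist_ext => *; apply: cl_le_antisym. Qed.

Lemma qfun_ext (X Y : QCat) (f g : QFun X Y) :
  (forall q (x : X q), f q x = g q x) -> f = g.
Proof.
case: f g => [f Hf] [g Hg] /= H.
have E : f = g by do 2 (apply: functional_extensionality_dep => ?); apply: H.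
by case: _ / E in Hg *; rewrite (proof_irrelevance _ Hf Hg).
Qed.

Definition qid (X : QCat) : QFun X X :=
  {| qmap := fun _ x => x; qmap_hom := fun _ _ _ _ => cl_le_refl _ |}.

Lemma qcomp_hom (X Y Z : QCat) (g : QFun Y Z) (f : QFun X Y)
    p q (x : X p) (x' : X q) :
  qhom X x x' ⊑ qhom Z (g _ (f _ x)) (g _ (f _ x')).
Proof. by apply: (cl_le_trans_r (qmap_hom g _ _)); apply: qmap_hom. Qed.

Definition qcomp (X Y Z : QCat) (g : QFun Y Z) (f : QFun X Y) : QFun X Z :=
  {| qmap := fun _ x => g _ (f _ x); qmap_hom := qcomp_hom g f |}.

Lemma dist_id_ax (X : QCat) :
  rel_le (rel_comp (@qhom X) (rel_comp (@qhom X) (@qhom X))) (@qhom X).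
Proof. by apply: dist_axI => *; apply: qhom_trans. Qed.

Definition dist_id (X : QCat) : Dist X X :=
  {| drel := @qhom X; dist_ax := @dist_id_ax X |}.

Lemma dist_comp_ax (X Y Z : QCat) (psi : Dist Y Z) (phi : Dist X Y) :
  rel_le (rel_comp (@qhom Z) (rel_comp (rel_comp psi phi) (@qhom X)))
         (rel_comp psi phi).
Proof.
apply: dist_axI => i j k.
  move=> x y y'; apply: comp_sup_ler => _ [l [z ->]]; rewrite comp_assoc.
  apply: (rel_comp_via z).
  by apply: comp_monol; apply: dist_actl.
move=> x x' y; apply: comp_sup_lel => _ [l [z ->]]; rewrite -comp_assoc.
apply: (rel_comp_via z).
by apply: comp_monor; apply: dist_actr.
Qed.

Definition dist_comp (X Y Z : QCat) (psi : Dist Y Z) (phi : Dist X Y) :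
  Dist X Z := {| drel := rel_comp psi phi; dist_ax := dist_comp_ax psi phi |}.

Lemma dist_sup_ax (X Y : QCat) (A : Dist X Y -> Prop) :
  let r : QRel X Y := fun p q x y =>
    cl_sup (fun u => exists phi, A phi /\ u = phi p q x y) in
  rel_le (rel_comp (@qhom Y) (rel_comp r (@qhom X))) r.
Proof.
apply: dist_axI => *.
  apply: comp_sup_ler => _ [phi [H ->]].
  apply: (cl_le_trans (dist_actl phi _ _ _) _).
  by apply: cl_sup_ub; exists phi.
apply: comp_sup_lel => _ [phi [H ->]].
apply: (cl_le_trans (dist_actr phi _ _ _) _).
by apply: cl_sup_ub; exists phi.
Qed.

Definition dist_sup (X Y : QCat) (A : Dist X Y -> Prop) : Dist X Y :=
  {| drel := fun p q x y =>
       cl_sup (fun u => exists phi, A phi /\ u = phi p q x y);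
     dist_ax := @dist_sup_ax X Y A |}.

Lemma dist_swarrow_ax (X Y Z : QCat) (gamma : Dist X Z) (alpha : Dist X Y) :
  let r : QRel Y Z := fun q t y z =>
    cl_inf (fun u => exists p (x : X p), u = gamma p t x z ↙ alpha p q x y) in
  rel_le (rel_comp (@qhom Z) (rel_comp r (@qhom Y))) r.
Proof.
apply: dist_axI => i j k.
  move=> y z z'; apply: cl_inf_greatest => _ [l [x ->]]; apply: swarrow_intro.
  apply: (cl_le_trans_r (dist_actl gamma _ z _)); rewrite -comp_assoc.
  apply: comp_monor; apply: swarrow_elim.
  by apply: cl_inf_lb; exists l, x.
move=> y y' z; apply: cl_inf_greatest => _ [l [x ->]]; apply: swarrow_intro.
rewrite -comp_assoc.
apply: (cl_le_trans (comp_monor (dist_actl alpha x y y')) _).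
by apply: swarrow_elim; apply: cl_inf_lb; exists l, x.
Qed.

Definition dist_swarrow (X Y Z : QCat) (gamma : Dist X Z) (alpha : Dist X Y) :
  Dist Y Z :=
  {| drel := fun q t y z =>
       cl_inf (fun u => exists p (x : X p), u = gamma p t x z ↙ alpha p q x y);
     dist_ax := dist_swarrow_ax gamma alpha |}.

Lemma dist_searrow_ax (X Y Z : QCat) (beta : Dist Y Z) (gamma : Dist X Z) :
  let r : QRel X Y := fun p q x y =>
    cl_inf (fun u => exists t (z : Z t), u = beta q t y z ↘ gamma p t x z) in
  rel_le (rel_comp (@qhom Y) (rel_comp r (@qhom X))) r.
Proof.
apply: dist_axI => i j k.
  move=> x y y'; apply: cl_inf_greatest => _ [l [z ->]]; apply: searrow_intro.
  rewrite comp_assoc.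
  apply: (cl_le_trans (comp_monol (dist_actr beta y y' z)) _).
  by apply: searrow_elim; apply: cl_inf_lb; exists l, z.
move=> x x' y; apply: cl_inf_greatest => _ [l [z ->]]; apply: searrow_intro.
apply: (cl_le_trans_r (dist_actr gamma _ x' _)); rewrite comp_assoc.
apply: comp_monol; apply: searrow_elim.
by apply: cl_inf_lb; exists l, z.
Qed.

Definition dist_searrow (X Y Z : QCat) (beta : Dist Y Z) (gamma : Dist X Z) :
  Dist X Y :=
  {| drel := fun p q x y =>
       cl_inf (fun u => exists t (z : Z t), u = beta q t y z ↘ gamma p t x z);
     dist_ax := dist_searrow_ax beta gamma |}.

Local Notation "s ⊙ r" := (dist_comp s r) : quantaloid_scope.
Local Notation "t ⇙ s" := (dist_swarrow t s) : quantaloid_scope.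
Local Notation "t ⇘ s" := (dist_searrow t s) : quantaloid_scope.
Local Notation "g ⋅ f" := (qcomp g f) : quantaloid_scope.

Lemma dist_swarrowP (X Y Z : QCat)
    (gamma : Dist X Z) (alpha : Dist X Y) (beta : Dist Y Z) :
  dist_le (beta ⊙ alpha) gamma <-> dist_le beta (gamma ⇙ alpha).
Proof.
split=> H.
  move=> q t y z; apply: cl_inf_greatest => _ [p [x ->]]; apply: swarrow_intro.
  by apply: (cl_le_trans_r (H _ _ _ _)); apply: rel_comp_ub.
apply: rel_comp_le => p q t x y z; apply: swarrow_elim.
by apply: (cl_le_trans (H _ _ _ _) _); apply: cl_inf_lb; exists p, x.
Qed.

Lemma dist_searrowP (X Y Z : QCat)
    (gamma : Dist X Z) (alpha : Dist X Y) (beta : Dist Y Z) :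
  dist_le (beta ⊙ alpha) gamma <-> dist_le alpha (beta ⇘ gamma).
Proof.
split=> H.
  move=> p q x y; apply: cl_inf_greatest => _ [t [z ->]]; apply: searrow_intro.
  by apply: (cl_le_trans_r (H _ _ _ _)); apply: rel_comp_ub.
apply: rel_comp_le => p q t x y z; apply: searrow_elim.
by apply: (cl_le_trans (H _ _ _ _) _); apply: cl_inf_lb; exists t, z.
Qed.

Lemma dist_comp_assoc (W X Y Z : QCat)
    (t : Dist Y Z) (s : Dist X Y) (r : Dist W X) :
  t ⊙ (s ⊙ r) = t ⊙ s ⊙ r.
Proof. by apply: dist_ext => *; apply: rel_comp_assoc. Qed.

Lemma dist_comp_mono (X Y Z : QCat) (s s' : Dist Y Z) (r r' : Dist X Y) :
  dist_le s s' -> dist_le r r' -> dist_le (s ⊙ r) (s' ⊙ r').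
Proof.
move=> H K; apply: rel_comp_le => p q k x y z.
by apply: (rel_comp_via y); apply: comp_mono.
Qed.

Definition graph_rel (X Y : QCat) (f : QFun X Y) : QRel X Y :=
  fun _ _ x y => qhom Y (f _ x) y.
Definition cograph_rel (X Y : QCat) (f : QFun X Y) : QRel Y X :=
  fun _ _ y x => qhom Y y (f _ x).

Lemma graph_ax (X Y : QCat) (f : QFun X Y) :
  rel_le (rel_comp (@qhom Y) (rel_comp (graph_rel f) (@qhom X))) (graph_rel f).
Proof.
apply: dist_axI => *; first exact: qhom_trans.
apply: (cl_le_trans_r (qhom_trans _ _ _)).
by apply: comp_monor; apply: qmap_hom.
Qed.

Lemma cograph_ax (X Y : QCat) (f : QFun X Y) :
  rel_le (rel_comp (@qhom X) (rel_comp (cograph_rel f) (@qhom Y)))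
         (cograph_rel f).
Proof.
apply: dist_axI => *; last exact: qhom_trans.
apply: (cl_le_trans_r (qhom_trans _ _ _)).
by apply: comp_monol; apply: qmap_hom.
Qed.

(* graph f is f_* and cograph f is f^*. *)
Definition graph (X Y : QCat) (f : QFun X Y) : Dist X Y :=
  {| drel := graph_rel f; dist_ax := graph_ax f |}.
Definition cograph (X Y : QCat) (f : QFun X Y) : Dist Y X :=
  {| drel := cograph_rel f; dist_ax := cograph_ax f |}.

Lemma comp_graphE (X Y Z : QCat) (phi : Dist Y Z) (f : QFun X Y)
    p q (x : X p) (z : Z q) :
  (phi ⊙ graph f) p q x z = phi p q (f _ x) z.
Proof.
apply: cl_le_antisym.
  by apply: rel_comp_least => *; apply: dist_actr.
apply: (rel_comp_via (f _ x)).
rewrite -{1}(comp_idr (phi _ _ _ _)).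
by apply: comp_monor; apply: qhom_refl.
Qed.

Lemma cograph_compE (X Y Z : QCat) (phi : Dist X Y) (f : QFun Z Y)
    p q (x : X p) (z : Z q) :
  (cograph f ⊙ phi) p q x z = phi p q x (f _ z).
Proof.
apply: cl_le_antisym.
  by apply: rel_comp_least => *; apply: dist_actl.
apply: (rel_comp_via (f _ z)).
rewrite -{1}(comp_idl (phi _ _ _ _)).
by apply: comp_monol; apply: qhom_refl.
Qed.

(* The underlying set of {s}: the fibre over q is a singleton if s = q, and
   empty otherwise.  Its element, of type s, is eq_refl. *)
Definition pt_car (s : Q) : QSet := fun q => s = q.

Definition pt_hom (s : Q) : QRel (pt_car s) (pt_car s) :=
  fun p q x y =>
    match x in _ = p, y in _ = q return hom p q with
    | eq_refl, eq_refl => idm s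
    end.

Lemma pt_refl (s : Q) : rel_le (rel_id (X := pt_car s)) (@pt_hom s).
Proof. by apply: rel_id_le => p x; destruct x; apply: cl_le_refl. Qed.

Lemma pt_trans (s : Q) : rel_le (rel_comp (@pt_hom s) (@pt_hom s)) (@pt_hom s).
Proof.
apply: rel_comp_le => p q r x y z; destruct x, y, z => /=.
by rewrite comp_idl; apply: cl_le_refl.
Qed.

Definition pt (s : Q) : QCat :=
  {| qcar := pt_car s; qhom := @pt_hom s;
     qcat_refl := @pt_refl s; qcat_trans := @pt_trans s |}.

(* The presheaf phi(-,y) and the copresheaf phi(x,-). *)
Definition col_rel (X Y : QCat) (phi : Dist X Y) q (y : Y q) : QRel X (pt q) :=
  fun p r x (e : q = r) =>
    match e in _ = r return hom p r with eq_refl => phi p q x y end.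
Definition row_rel (X Y : QCat) (phi : Dist X Y) p (x : X p) : QRel (pt p) Y :=
  fun r q (e : p = r) y =>
    match e in _ = r return hom r q with eq_refl => phi p q x y end.

Lemma col_ax (X Y : QCat) (phi : Dist X Y) q (y : Y q) :
  rel_le (rel_comp (@qhom (pt q)) (rel_comp (col_rel phi y) (@qhom X)))
         (col_rel phi y).
Proof.
apply: dist_axI.
  by move=> i j k x e e'; destruct e, e' => /=; rewrite comp_idl; apply: cl_le_refl.
by move=> i j k x x' e; destruct e => /=; apply: dist_actr.
Qed.

Lemma row_ax (X Y : QCat) (phi : Dist X Y) p (x : X p) :
  rel_le (rel_comp (@qhom Y) (rel_comp (row_rel phi x) (@qhom (pt p))))
         (row_rel phi x).
Proof.
apply: dist_axI; first by move=> i j k e z z'; destruct e => /=; apply: dist_actl.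
by move=> i j k e e' y; destruct e, e' => /=; rewrite comp_idr; apply: cl_le_refl.
Qed.

Definition col (X Y : QCat) (phi : Dist X Y) q (y : Y q) : Dist X (pt q) :=
  {| drel := col_rel phi y; dist_ax := col_ax phi y |}.
Definition row (X Y : QCat) (phi : Dist X Y) p (x : X p) : Dist (pt p) Y :=
  {| drel := row_rel phi x; dist_ax := row_ax phi x |}.

(* tau ⇙ sigma : {|sigma|} -/-> {|tau|} has a single component. *)
Definition psh_hom (X : QCat) : QRel (fun s => Dist X (pt s)) (fun s => Dist X (pt s)) :=
  fun s t sigma tau => (tau ⇙ sigma) s t eq_refl eq_refl.
Definition copsh_hom (X : QCat) : QRel (fun s => Dist (pt s) X) (fun s => Dist (pt s) X) :=
  fun s t sigma tau => (tau ⇘ sigma) s t eq_refl eq_refl.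

Lemma psh_homP (X : QCat) s t (sigma : Dist X (pt s)) (tau : Dist X (pt t)) u :
  u ⊑ psh_hom sigma tau <->
  forall p (x : X p), u ∘ sigma p s x eq_refl ⊑ tau p t x eq_refl.
Proof.
split=> [H p x|H].
  apply: swarrow_elim; apply: cl_le_trans H _.
  by apply: cl_inf_lb; exists p, x.
by apply: cl_inf_greatest => _ [p [x ->]]; apply: swarrow_intro.
Qed.

Lemma copsh_homP (X : QCat) s t (sigma : Dist (pt s) X) (tau : Dist (pt t) X) u :
  u ⊑ copsh_hom sigma tau <->
  forall p (x : X p), tau t p eq_refl x ∘ u ⊑ sigma s p eq_refl x.
Proof.
split=> [H p x|H].
  apply: searrow_elim; apply: cl_le_trans H _.
  by apply: cl_inf_lb; exists p, x.
by apply: cl_inf_greatest => _ [p [x ->]]; apply: searrow_intro.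
Qed.

Lemma psh_refl (X : QCat) : rel_le (rel_id (X := _)) (@psh_hom X).
Proof.
apply: rel_id_le => s sigma; apply/psh_homP => p x.
by rewrite comp_idl; apply: cl_le_refl.
Qed.

Lemma psh_trans (X : QCat) : rel_le (rel_comp (@psh_hom X) (@psh_hom X)) (@psh_hom X).
Proof.
apply: rel_comp_le => s t r rho sigma tau; apply/psh_homP => p x.
rewrite -comp_assoc.
have /psh_homP H := cl_le_refl (psh_hom rho sigma).
have /psh_homP K := cl_le_refl (psh_hom sigma tau).
by apply: (cl_le_trans_r (K _ x)); apply: comp_monor.
Qed.

Lemma copsh_refl (X : QCat) : rel_le (rel_id (X := _)) (@copsh_hom X).
Proof.
apply: rel_id_le => s sigma; apply/copsh_homP => p x.
by rewrite comp_idr; apply: cl_le_refl.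
Qed.

Lemma copsh_trans (X : QCat) :
  rel_le (rel_comp (@copsh_hom X) (@copsh_hom X)) (@copsh_hom X).
Proof.
apply: rel_comp_le => s t r rho sigma tau; apply/copsh_homP => p x.
rewrite comp_assoc.
have /copsh_homP H := cl_le_refl (copsh_hom rho sigma).
have /copsh_homP K := cl_le_refl (copsh_hom sigma tau).
by apply: (cl_le_trans_r (H _ x)); apply: comp_monol.
Qed.

Definition Psh (X : QCat) : QCat :=
  {| qcar := fun s => Dist X (pt s); qhom := @psh_hom X;
     qcat_refl := @psh_refl X; qcat_trans := @psh_trans X |}.

Definition Copsh (X : QCat) : QCat :=
  {| qcar := fun s => Dist (pt s) X; qhom := @copsh_hom X;
     qcat_refl := @copsh_refl X; qcat_trans := @copsh_trans X |}.

Lemma precomp_hom (X Y : QCat) (phi : Dist X Y) s t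
    (sigma : Psh Y s) (tau : Psh Y t) :
  psh_hom sigma tau ⊑ psh_hom (sigma ⊙ phi) (tau ⊙ phi).
Proof.
apply/psh_homP => p x; apply: comp_sup_ler => _ [q [y ->]]; rewrite comp_assoc.
apply: (rel_comp_via y); apply: comp_monol.
by move: q y {phi p x}; apply/psh_homP; apply: cl_le_refl.
Qed.

Definition precomp (X Y : QCat) (phi : Dist X Y) : QFun (Psh Y) (Psh X) :=
  {| qmap := fun s (sigma : Psh Y s) => (sigma ⊙ phi : Psh X s);
     qmap_hom := precomp_hom phi |}.

Lemma postcomp_hom (X Y : QCat) (phi : Dist X Y) s t
    (sigma : Copsh X s) (tau : Copsh X t) :
  copsh_hom sigma tau ⊑ copsh_hom (phi ⊙ sigma) (phi ⊙ tau).
Proof.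
apply/copsh_homP => p x; apply: comp_sup_lel => _ [q [y ->]].
rewrite -comp_assoc.
apply: (rel_comp_via y); apply: comp_monor.
by move: q y {phi p x}; apply/copsh_homP; apply: cl_le_refl.
Qed.

Definition postcomp (X Y : QCat) (phi : Dist X Y) : QFun (Copsh X) (Copsh Y) :=
  {| qmap := fun s (tau : Copsh X s) => (phi ⊙ tau : Copsh Y s);
     qmap_hom := postcomp_hom phi |}.

Lemma transpose_hom (X Y : QCat) (phi : Dist X Y) p q (y : Y p) (y' : Y q) :
  qhom Y y y' ⊑ psh_hom (col phi y) (col phi y').
Proof. by apply/psh_homP => r x /=; apply: dist_actl. Qed.

(* The Q-functor Y -> PX, y |-> phi(-,y). *)
Definition transpose (X Y : QCat) (phi : Dist X Y) : QFun Y (Psh X) :=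
  {| qmap := fun q y => (col phi y : Psh X q);
     qmap_hom := transpose_hom phi |}.

Definition yoneda (X : QCat) : QFun X (Psh X) := transpose (dist_id X).

Lemma coyoneda_hom (X : QCat) p q (x : X p) (x' : X q) :
  qhom X x x' ⊑ copsh_hom (row (dist_id X) x) (row (dist_id X) x').
Proof. by apply/copsh_homP => r y /=; apply: qhom_trans. Qed.

Definition coyoneda (X : QCat) : QFun X (Copsh X) :=
  {| qmap := fun q x => (row (dist_id X) x : Copsh X q);
     qmap_hom := @coyoneda_hom X |}.

Record TwoFunctor : Type := {
  tob :> QCat -> QCat;
  tmap : forall X Y, QFun X Y -> QFun (tob X) (tob Y);
  tmap_id : forall X, tmap (qid X) = qid (tob X);
  tmap_comp : forall X Y Z (g : QFun Y Z) (f : QFun X Y),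
    tmap (g ⋅ f) = tmap g ⋅ tmap f;
  tmap_mono : forall X Y (f g : QFun X Y),
    qfun_le f g -> qfun_le (tmap f) (tmap g) }.

Arguments tmap T {X Y} _ : rename.

Lemma tcomp_id (S T : TwoFunctor) X : tmap S (tmap T (qid X)) = qid (S (T X)).
Proof. by rewrite !tmap_id. Qed.

Lemma tcomp_comp (S T : TwoFunctor) X Y Z (g : QFun Y Z) (f : QFun X Y) :
  tmap S (tmap T (g ⋅ f)) = tmap S (tmap T g) ⋅ tmap S (tmap T f).
Proof. by rewrite !tmap_comp. Qed.

Lemma tcomp_mono (S T : TwoFunctor) X Y (f g : QFun X Y) :
  qfun_le f g -> qfun_le (tmap S (tmap T f)) (tmap S (tmap T g)).
Proof. by move=> H; do 2 apply: tmap_mono. Qed.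

Definition tcomp (S T : TwoFunctor) : TwoFunctor :=
  {| tob := fun X => S (T X);
     tmap := fun X Y f => tmap S (tmap T f);
     tmap_id := tcomp_id S T;
     tmap_comp := tcomp_comp S T;
     tmap_mono := @tcomp_mono S T |}.

(* Hom-orders being preorders, 2-naturality is naturality. *)
Record TwoMonad (T : TwoFunctor) : Type := {
  mmult : forall X, QFun (T (T X)) (T X);
  munit : forall X, QFun X (T X);
  mmult_nat : forall X Y (f : QFun X Y),
    mmult Y ⋅ tmap T (tmap T f) = tmap T f ⋅ mmult X;
  munit_nat : forall X Y (f : QFun X Y), munit Y ⋅ f = tmap T f ⋅ munit X;
  mmult_assoc : forall X, mmult X ⋅ mmult (T X) = mmult X ⋅ tmap T (mmult X);
  mmult_unitl : forall X, mmult X ⋅ munit (T X) = qid (T X);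
  mmult_unitr : forall X, mmult X ⋅ tmap T (munit X) = qid (T X) }.

Record monad_morphism (T S : TwoFunctor) (M : TwoMonad T) (N : TwoMonad S)
    (theta : forall X, QFun (T X) (S X)) : Prop := {
  mm_nat : forall X Y (f : QFun X Y),
    theta Y ⋅ tmap T f = tmap S f ⋅ theta X;
  mm_unit : forall X, theta X ⋅ munit M X = munit N X;
  mm_mult : forall X,
    theta X ⋅ mmult M X = mmult N X ⋅ (theta (S X) ⋅ tmap T (theta X)) }.

(* Agreement of E with T on objects is in its type. *)
Record lax_extension (T : TwoFunctor) (M : TwoMonad T)
    (E : forall X Y, Dist X Y -> Dist (T X) (T Y)) : Prop := {
  lax_mono : forall X Y (phi psi : Dist X Y),
    dist_le phi psi -> dist_le (E _ _ phi) (E _ _ psi);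
  lax_id : forall X, dist_le (dist_id (T X)) (E _ _ (dist_id X));
  lax_comp : forall X Y Z (psi : Dist Y Z) (phi : Dist X Y),
    dist_le (E _ _ psi ⊙ E _ _ phi) (E _ _ (psi ⊙ phi));
  lax_graph : forall X Y (f : QFun X Y),
    dist_le (graph (tmap T f)) (E _ _ (graph f));
  lax_cograph : forall X Y (f : QFun X Y),
    dist_le (cograph (tmap T f)) (E _ _ (cograph f));
  lax_mult : forall X Y (phi : Dist X Y),
    dist_le (graph (mmult M Y) ⊙ E _ _ (E _ _ phi)) (E _ _ phi ⊙ graph (mmult M X));
  lax_unit : forall X Y (phi : Dist X Y),
    dist_le (graph (munit M Y) ⊙ phi) (E _ _ phi ⊙ graph (munit M X)) }.

Record flat_lax_extension (T : TwoFunctor) (M : TwoMonad T)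
    (E : forall X Y, Dist X Y -> Dist (T X) (T Y)) : Prop := {
  flat_lax : lax_extension M E;
  flat_graph : forall X Y (f : QFun X Y), graph (tmap T f) = E _ _ (graph f);
  flat_cograph : forall X Y (f : QFun X Y),
    cograph (tmap T f) = E _ _ (cograph f) }.

(* phi |-> (T phi^<-)^* ∘ (T y_X)_*, written as T with an overline. *)
Definition bar (T : TwoFunctor) (X Y : QCat) (phi : Dist X Y) :
  Dist (T X) (T Y) :=
  cograph (tmap T (transpose phi)) ⊙ graph (tmap T (yoneda X)).

Lemma cograph_id (X : QCat) : cograph (qid X) = dist_id X.
Proof. exact: dist_ext. Qed.

Lemma graph_id (X : QCat) : graph (qid X) = dist_id X.
Proof. exact: dist_ext. Qed.

Lemma dist_comp_idr (X Y : QCat) (phi : Dist X Y) : phi ⊙ dist_id X = phi.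
Proof. by apply: dist_ext => *; rewrite -graph_id comp_graphE. Qed.

Lemma dist_comp_idl (X Y : QCat) (phi : Dist X Y) : dist_id Y ⊙ phi = phi.
Proof. by apply: dist_ext => *; rewrite -cograph_id cograph_compE. Qed.

Lemma graph_comp (X Y Z : QCat) (g : QFun Y Z) (f : QFun X Y) :
  graph (g ⋅ f) = graph g ⊙ graph f.
Proof. by apply: dist_ext => *; rewrite comp_graphE. Qed.

Lemma cograph_comp (X Y Z : QCat) (g : QFun Y Z) (f : QFun X Y) :
  cograph (g ⋅ f) = cograph f ⊙ cograph g.
Proof. by apply: dist_ext => *; rewrite cograph_compE. Qed.

Lemma graph_le (X Y : QCat) (f g : QFun X Y) :
  qfun_le f g -> dist_le (graph g) (graph f).
Proof.
move=> H p q x y /=; apply: (cl_le_trans_r (qhom_trans (f _ x) (g _ x) y)).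
rewrite -{1}(comp_idr (graph_rel _ _ _)).
exact: comp_monor.
Qed.

Lemma cograph_le (X Y : QCat) (f g : QFun X Y) :
  qfun_le f g -> dist_le (cograph f) (cograph g).
Proof.
move=> H p q y x /=; apply: (cl_le_trans_r (qhom_trans y (f _ x) (g _ x))).
rewrite -{1}(comp_idl (cograph_rel _ _ _)).
exact: comp_monol.
Qed.

Lemma psh_le (X : QCat) s (sigma tau : Psh X s) :
  dist_le sigma tau -> idm s ⊑ qhom (Psh X) sigma tau.
Proof. by move=> H; apply/psh_homP => p x; rewrite comp_idl; apply: H. Qed.

Lemma copsh_le (X : QCat) s (sigma tau : Copsh X s) :
  dist_le tau sigma -> idm s ⊑ qhom (Copsh X) sigma tau.
Proof. by move=> H; apply/copsh_homP => p x; rewrite comp_idr; apply: H. Qed.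

Lemma dist_le_refl (X Y : QCat) (phi : Dist X Y) : dist_le phi phi.
Proof. by move=> *; apply: cl_le_refl. Qed.

Definition psh_map (X Y : QCat) (f : QFun X Y) : QFun (Psh X) (Psh Y) :=
  precomp (cograph f).
Definition copsh_map (X Y : QCat) (f : QFun X Y) : QFun (Copsh X) (Copsh Y) :=
  postcomp (graph f).

Lemma psh_map_id (X : QCat) : psh_map (qid X) = qid (Psh X).
Proof. by apply: qfun_ext => q s /=; rewrite cograph_id dist_comp_idr. Qed.

Lemma psh_map_comp (X Y Z : QCat) (g : QFun Y Z) (f : QFun X Y) :
  psh_map (g ⋅ f) = psh_map g ⋅ psh_map f.
Proof.
by apply: qfun_ext => q s /=; rewrite cograph_comp dist_comp_assoc.
Qed.

Lemma psh_map_mono (X Y : QCat) (f g : QFun X Y) :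
  qfun_le f g -> qfun_le (psh_map f) (psh_map g).
Proof.
move=> H s sigma; apply: psh_le.
by apply: dist_comp_mono; [apply: dist_le_refl | apply: cograph_le].
Qed.

Lemma copsh_map_id (X : QCat) : copsh_map (qid X) = qid (Copsh X).
Proof. by apply: qfun_ext => q s /=; rewrite graph_id dist_comp_idl. Qed.

Lemma copsh_map_comp (X Y Z : QCat) (g : QFun Y Z) (f : QFun X Y) :
  copsh_map (g ⋅ f) = copsh_map g ⋅ copsh_map f.
Proof.
by apply: qfun_ext => q s /=; rewrite graph_comp dist_comp_assoc.
Qed.

Lemma copsh_map_mono (X Y : QCat) (f g : QFun X Y) :
  qfun_le f g -> qfun_le (copsh_map f) (copsh_map g).
Proof.
move=> H s sigma; apply: copsh_le.
by apply: dist_comp_mono; [apply: graph_le | apply: dist_le_refl].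
Qed.

Definition PF : TwoFunctor :=
  {| tob := Psh; tmap := psh_map; tmap_id := psh_map_id;
     tmap_comp := psh_map_comp; tmap_mono := psh_map_mono |}.

Definition PdF : TwoFunctor :=
  {| tob := Copsh; tmap := copsh_map; tmap_id := copsh_map_id;
     tmap_comp := copsh_map_comp; tmap_mono := copsh_map_mono |}.

Definition PPdF : TwoFunctor := tcomp PF PdF.

Definition dp_unit (X : QCat) : QFun X (PPdF X) :=
  yoneda (PdF X) ⋅ coyoneda X.

Definition dp_mult (X : QCat) : QFun (PPdF (PPdF X)) (PPdF X) :=
  precomp (graph (coyoneda (PPdF X) ⋅ yoneda (PdF X))).

Lemma psh_ext (X : QCat) s (sigma tau : Psh X s) :
  (forall p (x : X p), sigma p s x eq_refl = tau p s x eq_refl) -> sigma = tau.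
Proof. by move=> H; apply: dist_ext => p q x e; destruct e. Qed.

Lemma copsh_ext (X : QCat) s (sigma tau : Copsh X s) :
  (forall p (x : X p), sigma s p eq_refl x = tau s p eq_refl x) -> sigma = tau.
Proof. by move=> H; apply: dist_ext => p q e; destruct e. Qed.

Lemma le_extP (L : CompleteLattice) (x y : L) :
  (forall u, u ⊑ x <-> u ⊑ y) -> x = y.
Proof.
move=> H; apply: cl_le_antisym; first exact/(proj1 (H x))/cl_le_refl.
exact/(proj2 (H y))/cl_le_refl.
Qed.

Lemma yonedaE (X : QCat) p s (x : X p) (sigma : Psh X s) :
  qhom (Psh X) (yoneda X _ x) sigma = sigma p s x eq_refl.
Proof.
apply: le_extP => u; split=> [/psh_homP H|H].
  apply: (cl_le_trans_r (H p x)) => /=.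
  rewrite -{1}(comp_idr u); apply: comp_monor.
  exact: qhom_refl.
apply/psh_homP => q y /=; apply: (cl_le_trans_r (dist_actr sigma y x _)).
exact: comp_mono H (cl_le_refl _).
Qed.

Lemma coyonedaE (X : QCat) p s (x : X p) (sigma : Copsh X s) :
  qhom (Copsh X) sigma (coyoneda X _ x) = sigma s p eq_refl x.
Proof.
apply: le_extP => u; split=> [/copsh_homP H|H].
  apply: (cl_le_trans_r (H p x)) => /=.
  rewrite -{1}(comp_idl u); apply: comp_monol.
  exact: qhom_refl.
apply/copsh_homP => q y /=; apply: (cl_le_trans_r (dist_actl sigma _ x y)).
exact: comp_monor H.
Qed.

Lemma coyoneda_ff (X : QCat) : fully_faithful (coyoneda X).
Proof. by move=> p q x x'; rewrite coyonedaE. Qed.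

(* P†f has the left adjoint tau |-> f^* ∘ tau. *)
Lemma copsh_map_adj (X Y : QCat) (f : QFun X Y) s t
    (sigma : Copsh Y s) (tau : Copsh X t) :
  qhom (Copsh Y) sigma (copsh_map f _ tau) =
  qhom (Copsh X) (postcomp (cograph f) _ sigma) tau.
Proof.
apply: le_extP => u; split=> [/copsh_homP H|/copsh_homP H]; apply/copsh_homP.
  move=> p x; rewrite cograph_compE; apply: (cl_le_trans_r (H _ (f _ x))).
  apply: comp_monol.
  apply: (rel_comp_via x).
  rewrite -{1}(comp_idl (tau _ _ _ _)); apply: comp_monol.
  exact: qhom_refl.
move=> q y; apply: comp_sup_lel => _ [r [x ->]]; rewrite -comp_assoc.
apply: (cl_le_trans_r (dist_actl sigma _ (f _ x) y)).
apply: comp_monor.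
by move: (H _ x); rewrite cograph_compE.
Qed.

Lemma cograph_copsh_map (X Y : QCat) (f : QFun X Y) :
  cograph (copsh_map f) = graph (postcomp (cograph f)).
Proof. by apply: dist_ext => p q x y; apply: copsh_map_adj. Qed.

Lemma yoneda_nat (X Y : QCat) (f : QFun X Y) :
  yoneda Y ⋅ f = psh_map f ⋅ yoneda X.
Proof.
apply: qfun_ext => q x; apply: psh_ext => p y /=; apply: cl_le_antisym.
  apply: (rel_comp_via x) => /=.
  rewrite -{1}(comp_idl (qhom _ _ _)); apply: comp_monol.
  exact: qhom_refl.
apply: rel_comp_least => r x' /=; apply: (cl_le_trans_r (qhom_trans _ (f _ x') _)).
exact: comp_mono (qmap_hom f _ _) (cl_le_refl _).
Qed.

Lemma coyoneda_nat (X Y : QCat) (f : QFun X Y) :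
  coyoneda Y ⋅ f = copsh_map f ⋅ coyoneda X.
Proof.
apply: qfun_ext => q x; apply: copsh_ext => p y /=; apply: cl_le_antisym.
  apply: (rel_comp_via x) => /=.
  rewrite -{1}(comp_idr (qhom _ _ _)); apply: comp_monor.
  exact: qhom_refl.
apply: rel_comp_least => r x' /=; apply: (cl_le_trans_r (qhom_trans _ (f _ x') _)).
exact: comp_monor (qmap_hom f _ _).
Qed.

Lemma qcomp_assoc (W X Y Z : QCat)
    (h : QFun Y Z) (g : QFun X Y) (f : QFun W X) : h ⋅ (g ⋅ f) = h ⋅ g ⋅ f.
Proof. exact: qfun_ext. Qed.

Lemma dp_unit_nat (X Y : QCat) (f : QFun X Y) :
  dp_unit Y ⋅ f = tmap PPdF f ⋅ dp_unit X.
Proof.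
rewrite /dp_unit -qcomp_assoc coyoneda_nat !qcomp_assoc.
by congr (_ ⋅ _); exact: (yoneda_nat (copsh_map f)).
Qed.

Lemma precomp_comp (X Y Z : QCat) (psi : Dist Y Z) (phi : Dist X Y) :
  precomp phi ⋅ precomp psi = precomp (psi ⊙ phi).
Proof. by apply: qfun_ext => q s /=; rewrite dist_comp_assoc. Qed.

Lemma dp_mult_nat (X Y : QCat) (f : QFun X Y) :
  dp_mult Y ⋅ tmap PPdF (tmap PPdF f) = tmap PPdF f ⋅ dp_mult X.
Proof.
rewrite /dp_mult /= /psh_map !precomp_comp; congr precomp.
rewrite !cograph_copsh_map -!graph_comp; congr graph.
apply: qfun_ext => q tau; apply: copsh_ext => p z.
etransitivity; first exact: (cograph_compE (coyoneda _ _ (yoneda _ _ tau))).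
etransitivity; first exact: (yonedaE tau (precomp _ _ z)).
etransitivity; first exact: comp_graphE.
by symmetry; exact: (yonedaE (postcomp (cograph f) _ tau) z).
Qed.

Lemma dp_mult_unitl (X : QCat) :
  dp_mult X ⋅ dp_unit (PPdF X) = qid (PPdF X).
Proof.
apply: qfun_ext => s z; apply: psh_ext => p tau.
etransitivity; first exact: comp_graphE.
etransitivity; first by symmetry; exact: (coyoneda_ff (yoneda _ _ tau) z).
exact: yonedaE.
Qed.

Lemma dp_mult_unitr (X : QCat) :
  dp_mult X ⋅ tmap PPdF (dp_unit X) = qid (PPdF X).
Proof.
rewrite /dp_mult /= /psh_map precomp_comp.
suff -> : cograph (copsh_map (dp_unit X)) ⊙
          graph (coyoneda (PPdF X) ⋅ yoneda (PdF X)) = dist_id (PdF X).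
  by apply: qfun_ext => q s /=; rewrite dist_comp_idr.
rewrite cograph_copsh_map -graph_comp -graph_id; congr graph.
apply: qfun_ext => q tau; apply: copsh_ext => p x.
etransitivity; first exact: (cograph_compE (coyoneda _ _ (yoneda _ _ tau))).
etransitivity; first exact: (yonedaE tau (dp_unit X _ x)).
exact: (coyonedaE x tau).
Qed.

Lemma dp_mult_assoc (X : QCat) :
  dp_mult X ⋅ dp_mult (PPdF X) = dp_mult X ⋅ tmap PPdF (dp_mult X).
Proof.
rewrite /dp_mult /= /psh_map !precomp_comp; congr precomp.
rewrite cograph_copsh_map -!graph_comp; congr graph.
apply: qfun_ext => q tau; apply: copsh_ext => p z.
etransitivity; last first.
  symmetry.
  exact: (cograph_compE (coyoneda _ _ (yoneda _ _ tau)) (dp_mult X)).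
etransitivity; last by symmetry; exact: (yonedaE tau (dp_mult X _ z)).
etransitivity; last by symmetry; exact: comp_graphE.
exact: yonedaE.
Qed.

Definition double_presheaf : TwoMonad PPdF :=
  {| mmult := dp_mult; munit := dp_unit;
     mmult_nat := dp_mult_nat; munit_nat := dp_unit_nat;
     mmult_assoc := dp_mult_assoc;
     mmult_unitl := dp_mult_unitl; mmult_unitr := dp_mult_unitr |}.

Definition sub_hom (X : QCat) (P : forall q, X q -> Prop) :
  QRel (fun q => {x : X q | P q x}) (fun q => {x : X q | P q x}) :=
  fun _ _ x y => qhom X (proj1_sig x) (proj1_sig y).

Lemma sub_refl (X : QCat) (P : forall q, X q -> Prop) :
  rel_le (rel_id (X := _)) (sub_hom (P := P)).
Proof. by apply: rel_id_le => p x; apply: qhom_refl. Qed.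

Lemma sub_trans (X : QCat) (P : forall q, X q -> Prop) :
  rel_le (rel_comp (sub_hom (P := P)) (sub_hom (P := P))) (sub_hom (P := P)).
Proof. by apply: rel_comp_le => *; apply: qhom_trans. Qed.

Definition full_sub (X : QCat) (P : forall q, X q -> Prop) : QCat :=
  {| qcar := fun q => {x : X q | P q x}; qhom := sub_hom (P := P);
     qcat_refl := @sub_refl X P; qcat_trans := @sub_trans X P |}.

Definition sub_incl (X : QCat) (P : forall q, X q -> Prop) :
  QFun (full_sub P) X :=
  {| qmap := fun q (x : full_sub P q) => proj1_sig x;
     qmap_hom := fun _ _ _ _ => cl_le_refl _ |}.

Definition sub_lift (X Y : QCat) (P : forall q, Y q -> Prop) (f : QFun X Y)
    (Hf : forall q x, P q (f q x)) : QFun X (full_sub P) :=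
  {| qmap := fun q x => (exist _ (f q x) (Hf q x) : full_sub P q);
     qmap_hom := fun _ _ x x' => qmap_hom f x x' |}.

Lemma sub_ext (X Y : QCat) (P : forall q, Y q -> Prop)
    (f g : QFun X (full_sub P)) :
  sub_incl P ⋅ f = sub_incl P ⋅ g -> f = g.
Proof.
move=> H; apply: qfun_ext => q x; apply: eq_sig_hprop.
  by move=> ?; apply: proof_irrelevance.
by have := f_equal (fun h : QFun X Y => h q x) H.
Qed.

Definition conical (X : QCat) (s : Q) (sigma : Psh X s) : Prop :=
  exists A : X s -> Prop,
    sigma = dist_sup (fun rho : Psh X s => exists x, A x /\ rho = yoneda X s x).

Definition coconical (X : QCat) (s : Q) (tau : Copsh X s) : Prop :=
  exists A : X s -> Prop,
    tau = dist_sup (fun rho : Copsh X s => exists x, A x /\ rho = coyoneda X s x).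

Definition Con (X : QCat) : QCat := full_sub (@conical X).
Definition Cocon (X : QCat) : QCat := full_sub (@coconical X).

Lemma dist_comp_supl (X Y Z : QCat) (A : Dist Y Z -> Prop) (phi : Dist X Y) :
  dist_sup A ⊙ phi = dist_sup (fun rho => exists psi, A psi /\ rho = psi ⊙ phi).
Proof.
apply: dist_ext => p q x z; apply: cl_le_antisym.
  apply: rel_comp_least => r y; apply: comp_sup_lel => _ [psi [H ->]].
  apply: (cl_le_trans (rel_comp_ub psi phi x y z) _).
  by apply: cl_sup_ub; exists (psi ⊙ phi); split=> //; exists psi.
apply: cl_sup_least => _ [_ [[psi [H ->]] ->]].
apply: rel_comp_least => r y; apply: (rel_comp_via y).
by apply: comp_monol; apply: cl_sup_ub; exists psi.
Qed.

Lemma dist_comp_supr (X Y Z : QCat) (psi : Dist Y Z) (A : Dist X Y -> Prop) :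
  psi ⊙ dist_sup A = dist_sup (fun rho => exists phi, A phi /\ rho = psi ⊙ phi).
Proof.
apply: dist_ext => p q x z; apply: cl_le_antisym.
  apply: rel_comp_least => r y; apply: comp_sup_ler => _ [phi [H ->]].
  apply: (cl_le_trans (rel_comp_ub psi phi x y z) _).
  by apply: cl_sup_ub; exists (psi ⊙ phi); split=> //; exists phi.
apply: cl_sup_least => _ [_ [[phi [H ->]] ->]].
apply: rel_comp_least => r y; apply: (rel_comp_via y).
by apply: comp_monor; apply: cl_sup_ub; exists phi.
Qed.

Lemma dist_sup_eq (X Y : QCat) (A B : Dist X Y -> Prop) :
  (forall phi, A phi <-> B phi) -> dist_sup A = dist_sup B.
Proof.
move=> H; apply: dist_ext => p q x y /=.
apply: cl_le_antisym; apply: cl_sup_least => _ [phi [/H K ->]];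
  by apply: cl_sup_ub; exists phi.
Qed.

Lemma conical_map (X Y : QCat) (f : QFun X Y) s (sigma : Psh X s) :
  conical sigma -> conical (psh_map f s sigma).
Proof.
case=> A ->; exists (fun y => exists x, A x /\ y = f _ x).
rewrite /= dist_comp_supl; apply: dist_sup_eq => rho.
have E x : yoneda Y s (f _ x) = yoneda X s x ⊙ cograph f.
  exact: (f_equal (fun h : QFun X (Psh Y) => h s x) (yoneda_nat f)).
split=> [[_ [[x [Ax ->]] ->]]|[_ [[x [Ax ->]] ->]]].
  by exists (f _ x); split; [exists x | symmetry; exact: E].
by exists (yoneda X s x); split; [exists x | exact: E].
Qed.

Lemma coconical_map (X Y : QCat) (f : QFun X Y) s (tau : Copsh X s) :
  coconical tau -> coconical (copsh_map f s tau).
Proof.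
case=> A ->; exists (fun y => exists x, A x /\ y = f _ x).
rewrite /= dist_comp_supr; apply: dist_sup_eq => rho.
have E x : coyoneda Y s (f _ x) = graph f ⊙ coyoneda X s x.
  exact: (f_equal (fun h : QFun X (Copsh Y) => h s x) (coyoneda_nat f)).
split=> [[_ [[x [Ax ->]] ->]]|[_ [[x [Ax ->]] ->]]].
  by exists (f _ x); split; [exists x | symmetry; exact: E].
by exists (coyoneda X s x); split; [exists x | exact: E].
Qed.

Lemma dist_sup1 (X Y : QCat) (phi : Dist X Y) (A : Dist X Y -> Prop) :
  (forall psi, A psi <-> psi = phi) -> phi = dist_sup A.
Proof.
move=> H; apply: dist_ext => p q x y; apply: cl_le_antisym.
  by apply: cl_sup_ub; exists phi; split=> //; apply/H.
by apply: cl_sup_least => _ [psi [/H -> ->]]; apply: cl_le_refl.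
Qed.

Lemma yoneda_conical (X : QCat) s (x : X s) : conical (yoneda X s x).
Proof.
exists (fun y => y = x); apply: dist_sup1 => psi.
by split=> [[_ [-> ->]] //|->]; exists x.
Qed.

Lemma coyoneda_coconical (X : QCat) s (x : X s) : coconical (coyoneda X s x).
Proof.
exists (fun y => y = x); apply: dist_sup1 => psi.
by split=> [[_ [-> ->]] //|->]; exists x.
Qed.

Definition con_incl (X : QCat) : QFun (Con X) (Psh X) := sub_incl (@conical X).
Definition cocon_incl (X : QCat) : QFun (Cocon X) (Copsh X) :=
  sub_incl (@coconical X).

Definition con_yoneda (X : QCat) : QFun X (Con X) :=
  sub_lift (@yoneda_conical X).
Definition cocon_yoneda (X : QCat) : QFun X (Cocon X) :=
  sub_lift (@coyoneda_coconical X).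

Definition con_map (X Y : QCat) (f : QFun X Y) : QFun (Con X) (Con Y) :=
  sub_lift (P := @conical Y) (f := psh_map f ⋅ con_incl X)
    (fun s sigma => conical_map f (proj2_sig sigma)).

Definition cocon_map (X Y : QCat) (f : QFun X Y) : QFun (Cocon X) (Cocon Y) :=
  sub_lift (P := @coconical Y) (f := copsh_map f ⋅ cocon_incl X)
    (fun s tau => coconical_map f (proj2_sig tau)).

Lemma con_map_id (X : QCat) : con_map (qid X) = qid (Con X).
Proof.
by apply: sub_ext; apply: qfun_ext => q s; rewrite /= cograph_id dist_comp_idr.
Qed.

Lemma con_map_comp (X Y Z : QCat) (g : QFun Y Z) (f : QFun X Y) :
  con_map (g ⋅ f) = con_map g ⋅ con_map f.
Proof.
apply: sub_ext; apply: qfun_ext => q s.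
by rewrite /= cograph_comp dist_comp_assoc.
Qed.

Lemma con_map_mono (X Y : QCat) (f g : QFun X Y) :
  qfun_le f g -> qfun_le (con_map f) (con_map g).
Proof. by move=> H q s; apply: (psh_map_mono H). Qed.

Lemma cocon_map_id (X : QCat) : cocon_map (qid X) = qid (Cocon X).
Proof.
by apply: sub_ext; apply: qfun_ext => q s; rewrite /= graph_id dist_comp_idl.
Qed.

Lemma cocon_map_comp (X Y Z : QCat) (g : QFun Y Z) (f : QFun X Y) :
  cocon_map (g ⋅ f) = cocon_map g ⋅ cocon_map f.
Proof.
apply: sub_ext; apply: qfun_ext => q s.
by rewrite /= graph_comp dist_comp_assoc.
Qed.

Lemma cocon_map_mono (X Y : QCat) (f g : QFun X Y) :
  qfun_le f g -> qfun_le (cocon_map f) (cocon_map g).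
Proof. by move=> H q s; apply: (copsh_map_mono H). Qed.

Definition HF : TwoFunctor :=
  {| tob := Con; tmap := con_map; tmap_id := con_map_id;
     tmap_comp := con_map_comp; tmap_mono := con_map_mono |}.

Definition HdF : TwoFunctor :=
  {| tob := Cocon; tmap := cocon_map; tmap_id := cocon_map_id;
     tmap_comp := cocon_map_comp; tmap_mono := cocon_map_mono |}.

Definition HHdF : TwoFunctor := tcomp HF HdF.
Definition HdHF : TwoFunctor := tcomp HdF HF.

Definition hhd_unit (X : QCat) : QFun X (HHdF X) :=
  con_yoneda (HdF X) ⋅ cocon_yoneda X.

(* The multiplication with values in PH†X: these values need not be conical,
   i.e. lie in HH†X, when Q is not completely distributive. *)
Definition hhd_mult_pre (X : QCat) : QFun (HHdF (HHdF X)) (Psh (HdF X)) :=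
  precomp (graph (cocon_yoneda (HHdF X) ⋅ con_yoneda (HdF X))) ⋅
  con_incl (HdF (HHdF X)).

Definition hdh_unit (X : QCat) : QFun X (HdHF X) :=
  cocon_yoneda (HF X) ⋅ con_yoneda X.

Definition hdh_mult_pre (X : QCat) : QFun (HdHF (HdHF X)) (Copsh (HF X)) :=
  postcomp (cograph (con_yoneda (HdHF X) ⋅ cocon_yoneda (HF X))) ⋅
  cocon_incl (HF (HdHF X)).

(* Sigma |-> Sigma ∘ i_X^*. *)
Definition hhd_embed (X : QCat) : QFun (HHdF X) (PPdF X) :=
  psh_map (cocon_incl X) ⋅ con_incl (HdF X).

End QCategories.

Arguments qcomp {Q X Y Z} g f.
Notation "s ⊙ r" := (dist_comp s r) : quantaloid_scope.
Notation "t ⇙ s" := (dist_swarrow t s) : quantaloid_scope.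
Notation "t ⇘ s" := (dist_searrow t s) : quantaloid_scope.
Notation "g ⋅ f" := (qcomp g f) : quantaloid_scope.

(* Main.v *)
(* For any 2-functor T, bar T is monotone and lax functorial.  If moreover
   bar T (g^* ∘ f_* ) = (T g)^* ∘ (T f)_* for all cospans, then bar T is a flat
   lax extension of every 2-monad on T, the two monad inequalities being mates
   of the naturality squares.  The cospan condition holds for H and H†, where
   bar H phi (sigma, rho) = PX(sigma, rho ∘ phi) and
   bar H† phi (sigma, tau) = P†Y(phi ∘ sigma, tau), and it passes to composites
   together with bar (S T) = bar S (bar T).

   The monad laws of HH† and H†H are inherited along the injective embeddings
   into PP† and P†P.  Complete distributivity is needed for the multiplications
   to take conical values and to agree with those of PP† and P†P: it rewrites
   an infimum, over the generators z of a conical Theta, of suprema over the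
   generators of z as a supremum over choice functions. *)
From Stdlib Require Import ssreflect ProofIrrelevance.
Require Import Defs.

Set Implicit Arguments.
Unset Strict Implicit.
Unset Printing Implicit Defensive.

Local Open Scope quantaloid_scope.

Arguments qhom {Q} X {p q} _ _ : rename.
Arguments tmap {Q} T {X Y} _ : rename.
Arguments rel_comp_via {Q X Y Z q} y {s r p t x z c} _.

(** * Flat lax extensions of 2-monads *)

Section Lifting.
Variable Q : Quantaloid.

Lemma comp_le_idr (p q : Q) (b c : hom p q) (a : hom p p) :
  idm p ⊑ a -> b ∘ a ⊑ c -> b ⊑ c.
Proof.
move=> H; apply: cl_le_trans; rewrite -{1}(comp_idr b); exact: comp_monor.
Qed.

Lemma comp_le_idl (p q : Q) (b c : hom p q) (a : hom q q) :
  idm q ⊑ a -> a ∘ b ⊑ c -> b ⊑ c.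
Proof.
move=> H; apply: cl_le_trans; rewrite -{1}(comp_idl b); exact: comp_monol.
Qed.

Lemma yoneda_ff (X : QCat Q) : fully_faithful (yoneda X).
Proof. by move=> p q x x'; rewrite yonedaE. Qed.

(** Since [graph f] is left adjoint to [cograph f] among distributors, precomposition with
    [cograph f] is left adjoint to precomposition with [graph f]. *)
Lemma psh_map_adj (X Y : QCat Q) (f : QFun X Y) s t
    (sigma : Psh X s) (rho : Psh Y t) :
  qhom (Psh Y) (psh_map f _ sigma) rho =
  qhom (Psh X) sigma (precomp (graph f) _ rho).
Proof.
apply: le_extP => u; split=> [/psh_homP H|/psh_homP H]; apply/psh_homP.
  move=> p x; rewrite comp_graphE; apply: (cl_le_trans_r (H _ (f _ x))).
  apply: comp_monor; apply: (rel_comp_via x).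
  exact: (comp_le_idr (qhom_refl (f _ x)) (cl_le_refl _)).
move=> q y; apply: comp_sup_ler => _ [r [x ->]]; rewrite comp_assoc.
apply: (cl_le_trans_r (dist_actr rho y (f _ x) _)).
by apply: comp_monol; move: (H _ x); rewrite comp_graphE.
Qed.

Lemma graph_psh_map (X Y : QCat Q) (f : QFun X Y) :
  graph (psh_map f) = cograph (precomp (graph f)).
Proof. by apply: dist_ext => p q x y; apply: psh_map_adj. Qed.

Lemma postcomp_comp (X Y Z : QCat Q) (psi : Dist Y Z) (phi : Dist X Y) :
  postcomp psi ⋅ postcomp phi = postcomp (psi ⊙ phi).
Proof. by apply: qfun_ext => q s /=; rewrite dist_comp_assoc. Qed.

(** This is the Yoneda lemma. It exhibits every distributor as a composite [cograph g ⊙ graph f], so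
    a condition on cospans reaches all distributors. *)
Lemma transposeK (X Y : QCat Q) (phi : Dist X Y) :
  cograph (transpose phi) ⊙ graph (yoneda X) = phi.
Proof.
apply: dist_ext => p q x y; rewrite cograph_compE.
exact: (yonedaE x (transpose phi _ y)).
Qed.

Lemma graph_cograph_le (X Y : QCat Q) (f : QFun X Y) :
  dist_le (graph f ⊙ cograph f) (dist_id Y).
Proof. by apply: rel_comp_le => p q k x y z; apply: qhom_trans. Qed.

Lemma transpose_comp (X Y Z : QCat Q) (psi : Dist Y Z) (phi : Dist X Y) :
  transpose (psi ⊙ phi) = precomp phi ⋅ transpose psi.
Proof. by apply: qfun_ext => q z; apply: psh_ext. Qed.

Lemma precomp_yoneda (X Y : QCat Q) (phi : Dist X Y) :
  precomp phi ⋅ yoneda Y = transpose phi.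
Proof.
apply: qfun_ext => q z; apply: psh_ext => p x /=.
by apply: (eq_trans (cograph_compE phi (qid Y) x z)).
Qed.

(** The mate of a commuting square under the adjunctions of [f] and [g] between graph and
    cograph. *)
Lemma mate_le (A B C D : QCat Q) (f : QFun A B) (g : QFun C D)
    (a : QFun A C) (b : QFun B D) :
  b ⋅ f = g ⋅ a -> dist_le (graph a ⊙ cograph f) (cograph g ⊙ graph b).
Proof.
move=> H p q x y; rewrite cograph_compE.
apply: rel_comp_least => r z /=.
have E : b _ (f _ z) = g _ (a _ z).
  exact: (f_equal (fun h : QFun A D => h r z) H).
apply: (cl_le_trans (comp_mono (qmap_hom g _ _) (qmap_hom b _ _))).
by rewrite E; apply: qhom_trans.
Qed.

(** Under this condition [bar T phi] can be computed from any cospan representing [phi], not only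
    from the Yoneda cospan used to define it. *)
Definition preserves_cospans (T : TwoFunctor Q) : Prop :=
  forall (X Y Z : QCat Q) (f : QFun X Z) (g : QFun Y Z),
    bar T (cograph g ⊙ graph f) = cograph (tmap T g) ⊙ graph (tmap T f).

(** By definition [bar T phi] is already a cospan composite, to which [HS] applies. *)
Lemma bar_tcomp (S T : TwoFunctor Q) (HS : preserves_cospans S)
    (X Y : QCat Q) (phi : Dist X Y) :
  bar (tcomp S T) phi = bar S (bar T phi).
Proof. by rewrite [RHS]HS. Qed.

Lemma preserves_cospans_tcomp (S T : TwoFunctor Q) :
  preserves_cospans S -> preserves_cospans T ->
  preserves_cospans (tcomp S T).
Proof. by move=> HS HT X Y Z f g; rewrite bar_tcomp // HT HS. Qed.

Lemma bar_mono (T : TwoFunctor Q) (X Y : QCat Q) (phi psi : Dist X Y) :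
  dist_le phi psi -> dist_le (bar T phi) (bar T psi).
Proof.
move=> H; apply: dist_comp_mono; last exact: dist_le_refl.
apply: cograph_le; apply: tmap_mono => q y; apply: psh_le => p r x e.
by destruct e; apply: H.
Qed.

Lemma bar_comp (T : TwoFunctor Q) (X Y Z : QCat Q)
    (psi : Dist Y Z) (phi : Dist X Y) :
  dist_le (bar T psi ⊙ bar T phi) (bar T (psi ⊙ phi)).
Proof.
(* The transposes of [phi] and of [psi ⊙ phi] both factor through [precomp phi]. After cancelling
   common factors, the counit of the adjunction between graph and cograph of [tmap T (yoneda Y)]
   remains. *)
rewrite /bar transpose_comp -(precomp_yoneda phi) !tmap_comp !cograph_comp.
rewrite !dist_comp_assoc; apply: dist_comp_mono; last exact: dist_le_refl.
apply: dist_comp_mono; last exact: dist_le_refl.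
rewrite -dist_comp_assoc -{2}(dist_comp_idr (cograph (tmap T (transpose psi)))).
apply: dist_comp_mono; [exact: dist_le_refl | exact: graph_cograph_le].
Qed.

Lemma bar_graph (T : TwoFunctor Q) (HT : preserves_cospans T)
    (X Y : QCat Q) (f : QFun X Y) :
  bar T (graph f) = graph (tmap T f).
Proof.
have := HT _ _ _ f (qid Y).
by rewrite tmap_id !cograph_id !dist_comp_idl.
Qed.

Lemma bar_cograph (T : TwoFunctor Q) (HT : preserves_cospans T)
    (X Y : QCat Q) (f : QFun X Y) :
  bar T (cograph f) = cograph (tmap T f).
Proof.
have := HT _ _ _ (qid Y) f.
by rewrite tmap_id !graph_id !dist_comp_idr.
Qed.

Lemma bar_flat_lax_extension (T : TwoFunctor Q) (M : TwoMonad T) :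
  preserves_cospans T -> flat_lax_extension M (bar T).
Proof.
move=> HT; split=> [|X Y f|X Y f]; rewrite ?bar_graph ?bar_cograph //.
split.
- by move=> X Y phi psi; apply: bar_mono.
- move=> X; rewrite -(graph_id X) bar_graph // tmap_id graph_id.
  exact: dist_le_refl.
- by move=> X Y Z psi phi; apply: bar_comp.
- by move=> X Y f; rewrite bar_graph //; apply: dist_le_refl.
- by move=> X Y f; rewrite bar_cograph //; apply: dist_le_refl.
(* [HT] turns the iterated extension into a cospan composite of [tmap T (tmap T _)]. Naturality at
   [yoneda X] then makes the graph on the right a common factor, which leaves the mate of the
   naturality square at [transpose phi]. *)
- move=> X Y phi; rewrite {2}/bar HT /bar -[X in dist_le _ X]dist_comp_assoc.
  rewrite -graph_comp -mmult_nat graph_comp !dist_comp_assoc.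
  apply: dist_comp_mono; last exact: dist_le_refl.
  by apply: mate_le; rewrite mmult_nat.
(* The same argument for the unit, with [phi] itself written as its Yoneda cospan. *)
- move=> X Y phi; rewrite -{1}(transposeK phi) /bar.
  rewrite -[X in dist_le _ X]dist_comp_assoc.
  rewrite -graph_comp -munit_nat graph_comp !dist_comp_assoc.
  apply: dist_comp_mono; last exact: dist_le_refl.
  by apply: mate_le; rewrite munit_nat.
Qed.

(** * The cospan condition for conical presheaves and copresheaves *)

Lemma bar_conE (X Y : QCat Q) (phi : Dist X Y) p q
    (sigma : HF Q X p) (rho : HF Q Y q) :
  bar (HF Q) phi p q sigma rho =
  qhom (Psh X) (proj1_sig sigma) (precomp phi _ (proj1_sig rho)).
Proof.
rewrite /bar cograph_compE.
apply: (eq_trans (psh_map_adj (yoneda X) (proj1_sig sigma) _)).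
congr (qhom (Psh X) _ _).
by rewrite /= -dist_comp_assoc transposeK.
Qed.

Lemma bar_coconE (X Y : QCat Q) (phi : Dist X Y) p q
    (sigma : HdF Q X p) (tau : HdF Q Y q) :
  bar (HdF Q) phi p q sigma tau =
  qhom (Copsh Y) (postcomp phi _ (proj1_sig sigma)) (proj1_sig tau).
Proof.
rewrite /bar cograph_compE.
apply: (eq_trans (copsh_map_adj (transpose phi) _ (proj1_sig tau))).
congr (qhom (Copsh Y) _ _).
by rewrite /= dist_comp_assoc transposeK.
Qed.

(** Fullness of [Con] in [Psh] lets the adjunction for [psh_map f] be used on conical presheaves.
    Both sides become the hom from [sigma] to [rho ⊙ cograph g ⊙ graph f]. *)
Lemma con_preserves_cospans : preserves_cospans (HF Q).
Proof.
move=> X Y Z f g; apply: dist_ext => p q sigma rho.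
rewrite bar_conE cograph_compE.
rewrite [RHS](psh_map_adj f (proj1_sig sigma) _).
by rewrite /= dist_comp_assoc.
Qed.

Lemma cocon_preserves_cospans : preserves_cospans (HdF Q).
Proof.
move=> X Y Z f g; apply: dist_ext => p q sigma tau.
rewrite bar_coconE cograph_compE.
rewrite [RHS](copsh_map_adj g _ (proj1_sig tau)) /=.
by rewrite /= dist_comp_assoc.
Qed.
End Lifting.

(** * Transfer of monads along injective natural transformations *)

Section SubMonad.
Variable Q : Quantaloid.
Variables (T S : TwoFunctor Q) (N : TwoMonad S).
Variable theta : forall X : QCat Q, QFun (T X) (S X).
Hypothesis theta_nat : forall (X Y : QCat Q) (f : QFun X Y),
  theta Y ⋅ tmap T f = tmap S f ⋅ theta X.
Hypothesis theta_inj : forall (X : QCat Q) q (x y : T X q),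
  theta X q x = theta X q y -> x = y.
Variables (m : forall X : QCat Q, QFun (T (T X)) (T X))
          (e : forall X : QCat Q, QFun X (T X)).
Hypothesis theta_unit : forall X : QCat Q, theta X ⋅ e X = munit N X.
Hypothesis theta_mult : forall X : QCat Q,
  theta X ⋅ m X = mmult N X ⋅ (theta (S X) ⋅ tmap T (theta X)).

Lemma qfun_congr (X Y : QCat Q) (f g : QFun X Y) : f = g ->
  forall q (x : X q), f q x = g q x.
Proof. by move=> ->. Qed.

Let natE (X Y : QCat Q) (f : QFun X Y) q (x : T X q) :
  theta Y q (tmap T f q x) = tmap S f q (theta X q x).
Proof. exact: (qfun_congr (theta_nat f) x). Qed.

Let unitE (X : QCat Q) q (x : X q) : theta X q (e X q x) = munit N X q x.
Proof. exact: (qfun_congr (theta_unit X) x). Qed.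

(** Naturality exchanges the two expressions of the horizontal composite of [theta] with itself. The
    one chosen here applies [theta] innermost, so that all later rewriting takes place in [S]. *)
Let multE (X : QCat Q) q (x : T (T X) q) :
  theta X q (m X q x) = mmult N X q (tmap S (theta X) q (theta (T X) q x)).
Proof. by rewrite -natE; exact: (qfun_congr (theta_mult X) x). Qed.

Let tmapE (F : TwoFunctor Q) (X Y Z : QCat Q) (g : QFun Y Z) (f : QFun X Y)
    q (x : F X q) : tmap F g q (tmap F f q x) = tmap F (g ⋅ f) q x.
Proof. by rewrite tmap_comp. Qed.

Lemma sub_mult_nat (X Y : QCat Q) (f : QFun X Y) :
  m Y ⋅ tmap T (tmap T f) = tmap T f ⋅ m X.
Proof.
apply: qfun_ext => q x; apply: theta_inj => /=.
rewrite multE !natE multE tmapE theta_nat -tmapE.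
exact: (qfun_congr (mmult_nat N f) _).
Qed.

Lemma sub_unit_nat (X Y : QCat Q) (f : QFun X Y) :
  e Y ⋅ f = tmap T f ⋅ e X.
Proof.
apply: qfun_ext => q x; apply: theta_inj => /=.
rewrite unitE natE unitE; exact: (qfun_congr (munit_nat N f) _).
Qed.

Lemma sub_mult_assoc (X : QCat Q) : m X ⋅ m (T X) = m X ⋅ tmap T (m X).
Proof.
apply: qfun_ext => q x; apply: theta_inj => /=.
rewrite !multE natE tmapE theta_mult theta_nat -!tmapE.
(* Naturality of [mmult N] at [theta X] brings both sides to the two bracketings of [mmult N] on the
   same element. *)
rewrite -[LHS](f_equal (mmult N X q)
  (qfun_congr (mmult_nat N (theta X)) (tmap S (theta (T X)) q (theta _ q x)))).
exact: (qfun_congr (mmult_assoc N X) _).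
Qed.

Lemma sub_mult_unitl (X : QCat Q) : m X ⋅ e (T X) = qid (T X).
Proof.
apply: qfun_ext => q x; apply: theta_inj => /=.
rewrite multE unitE -[X in mmult N _ _ X](qfun_congr (munit_nat N (theta X)) x).
exact: (qfun_congr (mmult_unitl N X) _).
Qed.

Lemma sub_mult_unitr (X : QCat Q) : m X ⋅ tmap T (e X) = qid (T X).
Proof.
apply: qfun_ext => q x; apply: theta_inj => /=.
rewrite multE natE tmapE theta_unit.
exact: (qfun_congr (mmult_unitr N X) _).
Qed.

Definition sub_monad : TwoMonad T :=
  {| mmult := m; munit := e;
     mmult_nat := sub_mult_nat; munit_nat := sub_unit_nat;
     mmult_assoc := sub_mult_assoc;
     mmult_unitl := sub_mult_unitl; mmult_unitr := sub_mult_unitr |}.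

Lemma sub_monad_morphism : monad_morphism sub_monad N theta.
Proof. by split. Qed.
End SubMonad.

(** * The double copresheaf 2-monad *)

Section DoubleCopresheaf.
Variable Q : Quantaloid.

Definition PdPF : TwoFunctor Q := tcomp (PdF Q) (PF Q).

Definition dc_unit (X : QCat Q) : QFun X (PdPF X) :=
  coyoneda (PF Q X) ⋅ yoneda X.

Definition dc_mult (X : QCat Q) : QFun (PdPF (PdPF X)) (PdPF X) :=
  postcomp (cograph (yoneda (PdPF X) ⋅ coyoneda (PF Q X))).

Lemma dc_unit_nat (X Y : QCat Q) (f : QFun X Y) :
  dc_unit Y ⋅ f = tmap PdPF f ⋅ dc_unit X.
Proof.
rewrite /dc_unit -qcomp_assoc yoneda_nat !qcomp_assoc.
by congr (_ ⋅ _); exact: (coyoneda_nat (psh_map f)).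
Qed.

(** All functors in the square are postcompositions. Once [graph_psh_map] makes the distributors
    cographs, it suffices to compare two functors into presheaves, and the Yoneda and co-Yoneda
    lemmas evaluate both. *)
Lemma dc_mult_nat (X Y : QCat Q) (f : QFun X Y) :
  dc_mult Y ⋅ tmap PdPF (tmap PdPF f) = tmap PdPF f ⋅ dc_mult X.
Proof.
rewrite /dc_mult /= /copsh_map !postcomp_comp; congr postcomp.
rewrite !graph_psh_map -!cograph_comp; congr cograph.
apply: qfun_ext => q sigma; apply: psh_ext => p z.
etransitivity; first exact: (comp_graphE (yoneda _ _ (coyoneda _ _ sigma))).
etransitivity; first exact: (coyonedaE sigma (postcomp _ _ z)).
etransitivity; first exact: cograph_compE.
by symmetry; exact: (coyonedaE (precomp (graph f) _ sigma) z).
Qed.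

Lemma dc_mult_unitl (X : QCat Q) :
  dc_mult X ⋅ dc_unit (PdPF X) = qid (PdPF X).
Proof.
apply: qfun_ext => s z; apply: copsh_ext => p sigma.
etransitivity; first exact: cograph_compE.
etransitivity; first by symmetry; exact: (yoneda_ff z (coyoneda _ _ sigma)).
exact: coyonedaE.
Qed.

Lemma dc_mult_unitr (X : QCat Q) :
  dc_mult X ⋅ tmap PdPF (dc_unit X) = qid (PdPF X).
Proof.
rewrite /dc_mult /= /copsh_map postcomp_comp.
suff -> : cograph (yoneda (PdPF X) ⋅ coyoneda (PF Q X)) ⊙
          graph (psh_map (dc_unit X)) = dist_id (PF Q X).
  by apply: qfun_ext => q s /=; rewrite dist_comp_idl.
rewrite graph_psh_map -cograph_comp -cograph_id; congr cograph.
apply: qfun_ext => q sigma; apply: psh_ext => p x.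
etransitivity; first exact: (comp_graphE (yoneda _ _ (coyoneda _ _ sigma))).
etransitivity; first exact: (coyonedaE sigma (dc_unit X _ x)).
exact: (yonedaE x sigma).
Qed.

Lemma dc_mult_assoc (X : QCat Q) :
  dc_mult X ⋅ dc_mult (PdPF X) = dc_mult X ⋅ tmap PdPF (dc_mult X).
Proof.
rewrite /dc_mult /= /copsh_map !postcomp_comp; congr postcomp.
rewrite graph_psh_map -!cograph_comp; congr cograph.
apply: qfun_ext => q sigma; apply: psh_ext => p z.
etransitivity; last first.
  symmetry.
  exact: (comp_graphE (yoneda _ _ (coyoneda _ _ sigma)) (dc_mult X)).
etransitivity; last by symmetry; exact: (coyonedaE sigma (dc_mult X _ z)).
etransitivity; last by symmetry; exact: cograph_compE.
exact: coyonedaE.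
Qed.

Definition double_copresheaf : TwoMonad PdPF :=
  {| mmult := dc_mult; munit := dc_unit;
     mmult_nat := dc_mult_nat; munit_nat := dc_unit_nat;
     mmult_assoc := dc_mult_assoc;
     mmult_unitl := dc_mult_unitl; mmult_unitr := dc_mult_unitr |}.
End DoubleCopresheaf.

(** * Conical presheaves and copresheaves *)

Section Conical.
Variable Q : Quantaloid.

(* A conical presheaf is generated by the elements x with 1 <= sigma(x); this
   canonical choice of generators avoids the axiom of choice. *)
Lemma conicalP (X : QCat Q) s (sigma : Psh X s) :
  conical sigma <-> forall p (x : X p), sigma p s x eq_refl ⊑
    cl_sup (fun u => exists x' : X s,
              idm s ⊑ sigma s s x' eq_refl /\ u = qhom X x x').
Proof.
split=> [[A ->] p x|H].
  apply: cl_sup_least => _ [_ [[x' [Ax ->]] ->]].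
  apply: cl_sup_ub; exists x'; split=> //.
  apply: (cl_le_trans (qhom_refl x')); apply: cl_sup_ub.
  by exists (yoneda X s x'); split=> //; exists x'.
exists (fun x => idm s ⊑ sigma s s x eq_refl); apply: psh_ext => p x.
apply: cl_le_antisym.
  apply: (cl_le_trans (H p x)); apply: cl_sup_least => _ [x' [Hx ->]].
  by apply: cl_sup_ub; exists (yoneda X s x'); split=> //; exists x'.
apply: cl_sup_least => _ [_ [[x' [Hx ->]] ->]] /=.
exact: (comp_le_idl Hx (dist_actr sigma x x' _)).
Qed.

Lemma coconicalP (X : QCat Q) s (tau : Copsh X s) :
  coconical tau <-> forall p (x : X p), tau s p eq_refl x ⊑
    cl_sup (fun u => exists x' : X s,
              idm s ⊑ tau s s eq_refl x' /\ u = qhom X x' x).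
Proof.
split=> [[A ->] p x|H].
  apply: cl_sup_least => _ [_ [[x' [Ax ->]] ->]].
  apply: cl_sup_ub; exists x'; split=> //.
  apply: (cl_le_trans (qhom_refl x')); apply: cl_sup_ub.
  by exists (coyoneda X s x'); split=> //; exists x'.
exists (fun x => idm s ⊑ tau s s eq_refl x); apply: copsh_ext => p x.
apply: cl_le_antisym.
  apply: (cl_le_trans (H p x)); apply: cl_sup_least => _ [x' [Hx ->]].
  by apply: cl_sup_ub; exists (coyoneda X s x'); split=> //; exists x'.
apply: cl_sup_least => _ [_ [[x' [Hx ->]] ->]] /=.
exact: (comp_le_idr Hx (dist_actl tau _ x' x)).
Qed.

(** Complete distributivity as an elimination rule: an upper bound is checked on one choice function
    at a time, with any common lower bound [w] of the chosen values standing in for their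
    infimum. *)
Lemma cd_iinf_le (L : CompleteLattice) (HL : completely_distributive_lattice L)
    (I : Type) (J : I -> Type) (x : forall i, J i -> L) u v :
  (forall i, u ⊑ isup (x i)) ->
  (forall (c : forall i, J i) w, (forall i, w ⊑ x i (c i)) -> w ⊑ v) -> u ⊑ v.
Proof.
move=> Hu Hv; apply: (@cl_le_trans _ _ (iinf (fun i => isup (x i)))).
  by apply: cl_inf_greatest => _ [i ->].
rewrite HL; apply: cl_sup_least => _ [c ->]; apply: (Hv c) => i.
by apply: cl_inf_lb; exists i.
Qed.

(* Y has the infima in W of families of elements of one type. *)
Definition fibre_infima (Y W : QCat Q) (i : QFun Y W) : Prop :=
  forall s (I : Type) (c : I -> Y s), exists y : Y s,
    (forall k, idm s ⊑ qhom Y y (c k)) /\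
    (forall t (w : W t) u,
       (forall k, u ⊑ qhom W w (i _ (c k))) -> u ⊑ qhom W w (i _ y)).

Definition fibre_suprema (Y W : QCat Q) (i : QFun Y W) : Prop :=
  forall s (I : Type) (c : I -> Y s), exists y : Y s,
    (forall k, idm s ⊑ qhom Y (c k) y) /\
    (forall t (w : W t) u,
       (forall k, u ⊑ qhom W (i _ (c k)) w) -> u ⊑ qhom W (i _ y) w).

Lemma dist_sup_ub (X Y : QCat Q) (A : Dist X Y -> Prop) phi :
  A phi -> dist_le phi (dist_sup A).
Proof. by move=> H p q x y; apply: cl_sup_ub; exists phi. Qed.

(** Generators of a member stay generators of the supremum, because the value there only grows. *)
Lemma cocon_sup (X : QCat Q) s (I : Type) (c : I -> Cocon X s) :
  coconical (dist_sup (fun phi : Copsh X s => exists k, phi = proj1_sig (c k))).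
Proof.
apply/coconicalP => p x; apply: cl_sup_least => _ [_ [[k ->] ->]].
have /coconicalP H := proj2_sig (c k).
apply: (cl_le_trans (H p x)); apply: cl_sup_least => _ [x' [Hx ->]].
apply: cl_sup_ub; exists x'; split=> //; apply: (cl_le_trans Hx).
by apply: dist_sup_ub; exists k.
Qed.

Lemma con_sup (X : QCat Q) s (I : Type) (c : I -> Con X s) :
  conical (dist_sup (fun phi : Psh X s => exists k, phi = proj1_sig (c k))).
Proof.
apply/conicalP => p x; apply: cl_sup_least => _ [_ [[k ->] ->]].
have /conicalP H := proj2_sig (c k).
apply: (cl_le_trans (H p x)); apply: cl_sup_least => _ [x' [Hx ->]].
apply: cl_sup_ub; exists x'; split=> //; apply: (cl_le_trans Hx).
by apply: dist_sup_ub; exists k.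
Qed.

(** The order on copresheaves of one type is the reverse of the pointwise order, so pointwise
    suprema serve as infima. *)
Lemma cocon_fibre_infima (X : QCat Q) : fibre_infima (cocon_incl X).
Proof.
move=> s I c; exists (exist _ _ (cocon_sup c)); split=> [k|t w u H].
  by apply: copsh_le; apply: dist_sup_ub; exists k.
apply/copsh_homP => p x; apply: comp_sup_lel => _ [_ [[k ->] ->]].
by have /copsh_homP := H k; apply.
Qed.

Lemma con_fibre_suprema (X : QCat Q) : fibre_suprema (con_incl X).
Proof.
move=> s I c; exists (exist _ _ (con_sup c)); split=> [k|t w u H].
  by apply: psh_le; apply: dist_sup_ub; exists k.
apply/psh_homP => p x; apply: comp_sup_ler => _ [_ [[k ->] ->]].
by have /psh_homP := H k; apply.
Qed.

Lemma cocon_fibre_infima_id (X : QCat Q) : fibre_infima (qid (Cocon X)).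
Proof.
move=> s I c; have [y [H K]] := cocon_fibre_infima c; exists y; split=> //.
by move=> t w u Hw; apply: (K _ (cocon_incl X _ w)).
Qed.

Lemma con_fibre_suprema_id (X : QCat Q) : fibre_suprema (qid (Con X)).
Proof.
move=> s I c; have [y [H K]] := con_fibre_suprema c; exists y; split=> //.
by move=> t w u Hw; apply: (K _ (con_incl X _ w)).
Qed.

(** * Choice functions on generators and the multiplications *)

Hypothesis HQ : completely_distributive Q.

(* The witness y for a choice function is the infimum of the chosen elements. *)
Lemma cocon_con_distr (Y W : QCat Q) (i : QFun Y W) (Hi : fibre_infima i)
    s t (Theta : Cocon (Con Y) s) (w : W t) (u : hom t s) :
  (forall z : Con Y s, idm s ⊑ proj1_sig Theta s s eq_refl z ->
     u ⊑ (proj1_sig z ⊙ cograph i) t s w eq_refl) ->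
  u ⊑ cl_sup (fun v => exists y : Y s,
    idm s ⊑ qhom (Cocon (Con Y))
              (cocon_yoneda (Con Y) _ (con_yoneda Y _ y)) Theta /\
    v = qhom W w (i _ y)).
Proof.
move=> H.
pose I := {z : Con Y s | idm s ⊑ proj1_sig Theta s s eq_refl z}.
pose J (k : I) := {y : Y s | idm s ⊑ proj1_sig (proj1_sig k) s s y eq_refl}.
apply: (@cd_iinf_le _ (@HQ t s) I J
  (fun k y => qhom W w (i _ (proj1_sig y)))) => [[z Hz]|c v Hv].
  (* At [w], the presheaf [z ⊙ cograph i] is bounded by the supremum of the homs from [w] to the
     images of the generators of [z]. *)
  apply: (cl_le_trans (H z Hz)); apply: rel_comp_least => r y1.
  have /conicalP K := proj2_sig z.
  apply: (cl_le_trans (comp_monol (K _ y1))).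
  apply: comp_sup_lel => _ [y' [Hy ->]].
  apply: (cl_le_trans (comp_monol (qmap_hom i _ _))).
  apply: (cl_le_trans (qhom_trans _ _ _)).
  apply: cl_sup_ub.
  by exists (exist (fun y => idm s ⊑ proj1_sig z s s y eq_refl) y' Hy).
have [y [Hy Ky]] := Hi s I (fun k => proj1_sig (c k)).
apply: (cl_le_trans (Ky _ w v Hv)).
apply: cl_sup_ub; exists y; split=> //.
(* As [Theta] is generated by its [z'], it suffices that [y] belongs to each [z']. It does, since
   [y] lies below the generator of [z'] picked by [c]. *)
apply/copsh_homP => p z; rewrite comp_idr.
have /coconicalP K := proj2_sig Theta.
apply: (cl_le_trans (K _ z)); apply: cl_sup_least => _ [z' [Hz ->]].
have /= Hc := proj2_sig (c (exist _ z' Hz)).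
apply: (@comp_le_idr _ _ _ _ _ (qhom (Con Y) (con_yoneda Y _ y) z')).
  rewrite [X in _ ⊑ X](yonedaE y (proj1_sig z')).
  apply: (cl_le_trans (Hy (exist _ z' Hz))).
  exact: (comp_le_idl Hc (dist_actr (proj1_sig z') _ _ _)).
exact: (qhom_trans (con_yoneda Y _ y) z' z).
Qed.

(** Dual to [cocon_con_distr]: the witness for a choice function is the supremum of the chosen
    elements. *)
Lemma con_cocon_distr (Y W : QCat Q) (i : QFun Y W) (Hi : fibre_suprema i)
    s t (Theta : Con (Cocon Y) s) (w : W t) (u : hom s t) :
  (forall z : Cocon Y s, idm s ⊑ proj1_sig Theta s s z eq_refl ->
     u ⊑ (graph i ⊙ proj1_sig z) s t eq_refl w) ->
  u ⊑ cl_sup (fun v => exists y : Y s,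
    idm s ⊑ qhom (Con (Cocon Y)) Theta
              (con_yoneda (Cocon Y) _ (cocon_yoneda Y _ y)) /\
    v = qhom W (i _ y) w).
Proof.
move=> H.
pose I := {z : Cocon Y s | idm s ⊑ proj1_sig Theta s s z eq_refl}.
pose J (k : I) := {y : Y s | idm s ⊑ proj1_sig (proj1_sig k) s s eq_refl y}.
apply: (@cd_iinf_le _ (@HQ s t) I J
  (fun k y => qhom W (i _ (proj1_sig y)) w)) => [[z Hz]|c v Hv].
  apply: (cl_le_trans (H z Hz)); apply: rel_comp_least => r y1.
  have /coconicalP K := proj2_sig z.
  apply: (cl_le_trans (comp_monor (K _ y1))).
  apply: comp_sup_ler => _ [y' [Hy ->]].
  apply: (cl_le_trans (comp_monor (qmap_hom i _ _))).
  apply: (cl_le_trans (qhom_trans _ _ _)).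
  apply: cl_sup_ub.
  by exists (exist (fun y => idm s ⊑ proj1_sig z s s eq_refl y) y' Hy).
have [y [Hy Ky]] := Hi s I (fun k => proj1_sig (c k)).
apply: (cl_le_trans (Ky _ w v Hv)).
apply: cl_sup_ub; exists y; split=> //.
apply/psh_homP => p z; rewrite comp_idl.
have /conicalP K := proj2_sig Theta.
apply: (cl_le_trans (K _ z)); apply: cl_sup_least => _ [z' [Hz ->]].
have /= Hc := proj2_sig (c (exist _ z' Hz)).
apply: (@comp_le_idl _ _ _ _ _ (qhom (Cocon Y) z' (cocon_yoneda Y _ y))).
  rewrite [X in _ ⊑ X](coyonedaE y (proj1_sig z')).
  apply: (cl_le_trans (Hy (exist _ z' Hz))).
  exact: (comp_le_idr Hc (dist_actl (proj1_sig z') _ _ _)).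
exact: (qhom_trans z z' (cocon_yoneda Y _ y)).
Qed.

(** The value at [tau] is that of [Upsilon] at the image of [tau] under Yoneda followed by
    co-Yoneda. Below a generator [Theta] of [Upsilon], the distributivity lemma replaces this by
    homs from [tau] to elements [y] whose image lies below [Theta]; such [y] generate the new
    presheaf. *)
Lemma hhd_mult_conical (X : QCat Q) s (Upsilon : HHdF Q (HHdF Q X) s) :
  conical (hhd_mult_pre X s Upsilon).
Proof.
apply/conicalP => p tau.
rewrite [X in X ⊑ _]comp_graphE.
have /conicalP K := proj2_sig Upsilon.
apply: (cl_le_trans (K _ _)); apply: cl_sup_least => _ [Theta [HT ->]].
apply: (cl_le_trans (cocon_con_distr (@cocon_fibre_infima_id X)
  (Theta := Theta) (w := tau) _)) => [z Hz|].
  (* Acting by the hom into [Theta] sends the value of [Theta] at [z], which is above the identity,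
     into the value of [z] at [tau]. *)
  rewrite cograph_id dist_comp_idr -(yonedaE tau (proj1_sig z)).
  apply: (comp_le_idl Hz).
  set u := qhom _ _ _.
  by have /copsh_homP := cl_le_refl u; apply.
apply: cl_sup_least => _ [y [Hy ->]].
apply: cl_sup_ub; exists y; split=> //.
rewrite [X in _ ⊑ X]comp_graphE; apply: (cl_le_trans Hy).
exact: (comp_le_idl HT (dist_actr (proj1_sig Upsilon) _ _ _)).
Qed.

Lemma hdh_mult_coconical (X : QCat Q) s (Upsilon : HdHF Q (HdHF Q X) s) :
  coconical (hdh_mult_pre X s Upsilon).
Proof.
apply/coconicalP => p sigma.
rewrite [X in X ⊑ _]cograph_compE.
have /coconicalP K := proj2_sig Upsilon.
apply: (cl_le_trans (K _ _)); apply: cl_sup_least => _ [Theta [HT ->]].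
apply: (cl_le_trans (con_cocon_distr (@con_fibre_suprema_id X)
  (Theta := Theta) (w := sigma) _)) => [z Hz|].
  rewrite graph_id dist_comp_idl -(coyonedaE sigma (proj1_sig z)).
  apply: (comp_le_idr Hz).
  set u := qhom _ _ _.
  by have /psh_homP := cl_le_refl u; apply.
apply: cl_sup_least => _ [y [Hy ->]].
apply: cl_sup_ub; exists y; split=> //.
rewrite [X in _ ⊑ X]cograph_compE; apply: (cl_le_trans Hy).
exact: (comp_le_idr HT (dist_actl (proj1_sig Upsilon) _ _ _)).
Qed.

Definition hhd_mult (X : QCat Q) : QFun (HHdF Q (HHdF Q X)) (HHdF Q X) :=
  sub_lift (P := @conical Q (HdF Q X)) (@hhd_mult_conical X).

Definition hdh_mult (X : QCat Q) : QFun (HdHF Q (HdHF Q X)) (HdHF Q X) :=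
  sub_lift (P := @coconical Q (HF Q X)) (@hdh_mult_coconical X).

(** * Embeddings into the double presheaf and double copresheaf monads *)

Definition hdh_embed (X : QCat Q) : QFun (HdHF Q X) (PdPF Q X) :=
  copsh_map (con_incl X) ⋅ cocon_incl (HF Q X).

Lemma cograph_graph_ff (X Y : QCat Q) (f : QFun X Y) :
  fully_faithful f -> cograph f ⊙ graph f = dist_id X.
Proof.
move=> H; apply: dist_ext => p q x y; rewrite cograph_compE.
by apply: eq_sym; apply: H.
Qed.

Lemma hhd_embed_ff (X : QCat Q) : fully_faithful (hhd_embed X).
Proof.
move=> p q S T; rewrite [RHS](psh_map_adj (cocon_incl X)).
by rewrite /= -dist_comp_assoc cograph_graph_ff // dist_comp_idr.
Qed.

Lemma con_ext (X : QCat Q) s (x y : Con X s) :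
  proj1_sig x = proj1_sig y -> x = y.
Proof. by apply: eq_sig_hprop => ?; apply: proof_irrelevance. Qed.

Lemma cocon_ext (X : QCat Q) s (x y : Cocon X s) :
  proj1_sig x = proj1_sig y -> x = y.
Proof. by apply: eq_sig_hprop => ?; apply: proof_irrelevance. Qed.

(** Precomposing with [graph (cocon_incl X)] undoes the embedding, because the inclusion is fully
    faithful. *)
Lemma hhd_embed_inj (X : QCat Q) q (S T : HHdF Q X q) :
  hhd_embed X q S = hhd_embed X q T -> S = T.
Proof.
move=> H; apply: con_ext.
have := f_equal (fun R : Psh (PdF Q X) q => R ⊙ graph (cocon_incl X)) H.
by rewrite /= -!dist_comp_assoc cograph_graph_ff // !dist_comp_idr.
Qed.

Lemma hdh_embed_inj (X : QCat Q) q (S T : HdHF Q X q) :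
  hdh_embed X q S = hdh_embed X q T -> S = T.
Proof.
move=> H; apply: cocon_ext.
have := f_equal (fun R : Copsh (PF Q X) q => cograph (con_incl X) ⊙ R) H.
by rewrite /= !dist_comp_assoc cograph_graph_ff // !dist_comp_idl.
Qed.

Lemma hhd_embed_nat (X Y : QCat Q) (f : QFun X Y) :
  hhd_embed Y ⋅ tmap (HHdF Q) f = tmap (PPdF Q) f ⋅ hhd_embed X.
Proof.
apply: qfun_ext => q S /=.
rewrite -!dist_comp_assoc -!cograph_comp; congr (_ ⊙ cograph _).
exact: qfun_ext.
Qed.

Lemma hdh_embed_nat (X Y : QCat Q) (f : QFun X Y) :
  hdh_embed Y ⋅ tmap (HdHF Q) f = tmap (PdPF Q) f ⋅ hdh_embed X.
Proof.
apply: qfun_ext => q S /=.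
rewrite !dist_comp_assoc -!graph_comp; congr (graph _ ⊙ _).
exact: qfun_ext.
Qed.

Lemma hhd_embed_yoneda (X : QCat Q) :
  hhd_embed X ⋅ con_yoneda (HdF Q X) = yoneda (PdF Q X) ⋅ cocon_incl X.
Proof. by rewrite yoneda_nat; apply: qfun_ext. Qed.

Lemma hdh_embed_coyoneda (X : QCat Q) :
  hdh_embed X ⋅ cocon_yoneda (HF Q X) = coyoneda (PF Q X) ⋅ con_incl X.
Proof. by rewrite coyoneda_nat; apply: qfun_ext. Qed.

Lemma hhd_embed_unit (X : QCat Q) :
  hhd_embed X ⋅ hhd_unit X = munit (double_presheaf Q) X.
Proof.
rewrite /hhd_unit qcomp_assoc hhd_embed_yoneda -qcomp_assoc.
by congr (_ ⋅ _); apply: qfun_ext.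
Qed.

Lemma hdh_embed_unit (X : QCat Q) :
  hdh_embed X ⋅ hdh_unit X = munit (double_copresheaf Q) X.
Proof.
rewrite /hdh_unit qcomp_assoc hdh_embed_coyoneda -qcomp_assoc.
by congr (_ ⋅ _); apply: qfun_ext.
Qed.

(** Compatibility of the two multiplications, freed from the presheaf they act on. One inequality is
    a mate; the other is [cocon_con_distr] for infima that are universal among all copresheaves,
    hence the inclusion in place of the identity. *)
Lemma hhd_mult_graph (X : QCat Q) :
  graph (cocon_yoneda (HHdF Q X) ⋅ con_yoneda (HdF Q X)) ⊙
  cograph (cocon_incl X) =
  cograph (copsh_map (hhd_embed X) ⋅ cocon_incl (HHdF Q X)) ⊙
  graph (coyoneda (PPdF Q X) ⋅ yoneda (PdF Q X)).
Proof.
apply: dist_le_antisym.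
  apply: mate_le; rewrite -[LHS]qcomp_assoc -hhd_embed_yoneda.
  rewrite [LHS]qcomp_assoc [RHS]qcomp_assoc.
  by rewrite (coyoneda_nat (hhd_embed X)); congr (_ ⋅ _); apply: qfun_ext.
move=> t s w Theta; rewrite cograph_compE.
set u := graph _ _ _ _ _.
apply: (cl_le_trans (cocon_con_distr (@cocon_fibre_infima X)
  (Theta := Theta) (w := w) (u := u) _)) => [z Hz|].
  (* The pushforward of [Theta] along [hhd_embed X] is above the identity at the image of [z], since
     [Theta] is so at [z]. *)
  rewrite -[X in _ ⊑ X](yonedaE w (hhd_embed X _ z)).
  have /copsh_homP H := cl_le_refl u.
  apply: (comp_le_idl _ (H _ (hhd_embed X _ z))).
  apply: (cl_le_trans Hz); apply: (rel_comp_via z).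
  exact: (comp_le_idl (qhom_refl (hhd_embed X _ z)) (cl_le_refl _)).
apply: cl_sup_least => _ [y [Hy ->]]; apply: (rel_comp_via y).
exact: (comp_le_idl Hy (cl_le_refl _)).
Qed.

(** Dual to [hhd_mult_graph], with postcomposition and suprema universal among all presheaves. *)
Lemma hdh_mult_cograph (X : QCat Q) :
  graph (con_incl X) ⊙ cograph (con_yoneda (HdHF Q X) ⋅ cocon_yoneda (HF Q X)) =
  cograph (yoneda (PdPF Q X) ⋅ coyoneda (PF Q X)) ⊙
  graph (psh_map (hdh_embed X) ⋅ con_incl (HdHF Q X)).
Proof.
apply: dist_le_antisym.
  apply: mate_le; rewrite -[RHS]qcomp_assoc -hdh_embed_coyoneda.
  rewrite [LHS]qcomp_assoc [RHS]qcomp_assoc.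
  by rewrite (yoneda_nat (hdh_embed X)); congr (_ ⋅ _); apply: qfun_ext.
move=> s t Theta w; rewrite cograph_compE.
set u := graph _ _ _ _ _.
apply: (cl_le_trans (con_cocon_distr (@con_fibre_suprema X)
  (Theta := Theta) (w := w) (u := u) _)) => [z Hz|].
  rewrite -[X in _ ⊑ X](coyonedaE w (hdh_embed X _ z)).
  have /psh_homP H := cl_le_refl u.
  apply: (comp_le_idr _ (H _ (hdh_embed X _ z))).
  apply: (cl_le_trans Hz); apply: (rel_comp_via z).
  exact: (comp_le_idr (qhom_refl (hdh_embed X _ z)) (cl_le_refl _)).
apply: cl_sup_least => _ [y [Hy ->]]; apply: (rel_comp_via y).
exact: (comp_le_idr Hy (cl_le_refl _)).
Qed.

Lemma hhd_embed_mult (X : QCat Q) :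
  hhd_embed X ⋅ hhd_mult X = mmult (double_presheaf Q) X ⋅
    (hhd_embed (PPdF Q X) ⋅ tmap (HHdF Q) (hhd_embed X)).
Proof.
rewrite hhd_embed_nat; apply: qfun_ext => q S /=.
by rewrite -!dist_comp_assoc hhd_mult_graph cograph_comp -!dist_comp_assoc.
Qed.

Lemma hdh_embed_mult (X : QCat Q) :
  hdh_embed X ⋅ hdh_mult X = mmult (double_copresheaf Q) X ⋅
    (hdh_embed (PdPF Q X) ⋅ tmap (HdHF Q) (hdh_embed X)).
Proof.
rewrite hdh_embed_nat; apply: qfun_ext => q S /=.
by rewrite !dist_comp_assoc hdh_mult_cograph graph_comp !dist_comp_assoc.
Qed.

End Conical.

Theorem theorem5p8 (Q : Quantaloid) (HQ : completely_distributive Q) :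
  (exists M : TwoMonad (HHdF Q),
     (forall X : QCat Q, munit M X = hhd_unit X) /\
     (forall X : QCat Q,
        con_incl (HdF Q X) ⋅ mmult M X = hhd_mult_pre X) /\
     (forall X : QCat Q, fully_faithful (hhd_embed X)) /\
     monad_morphism M (double_presheaf Q) (@hhd_embed Q) /\
     flat_lax_extension M (bar (HHdF Q)) /\
     (forall (X Y : QCat Q) (phi : Dist X Y),
        bar (HHdF Q) phi = bar (HF Q) (bar (HdF Q) phi))) /\
  (exists N : TwoMonad (HdHF Q),
     (forall X : QCat Q, munit N X = hdh_unit X) /\
     (forall X : QCat Q,
        cocon_incl (HF Q X) ⋅ mmult N X = hdh_mult_pre X) /\
     flat_lax_extension N (bar (HdHF Q)) /\
     (forall (X Y : QCat Q) (phi : Dist X Y),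
        bar (HdHF Q) phi = bar (HdF Q) (bar (HF Q) phi))).
Proof.
have CH := @con_preserves_cospans Q; have CHd := @cocon_preserves_cospans Q.
split.
  exists (sub_monad (@hhd_embed_nat Q) (@hhd_embed_inj Q)
            (@hhd_embed_unit Q) (hhd_embed_mult HQ)).
  split; first by [].
  split; first by move=> X; apply: qfun_ext.
  split; first exact: hhd_embed_ff.
  split; first exact: sub_monad_morphism.
  split; first by apply: bar_flat_lax_extension; apply: preserves_cospans_tcomp.
  by move=> X Y phi; apply: bar_tcomp.
exists (sub_monad (@hdh_embed_nat Q) (@hdh_embed_inj Q)
          (@hdh_embed_unit Q) (hdh_embed_mult HQ)).
split; first by [].
split; first by move=> X; apply: qfun_ext.
split; first by apply: bar_flat_lax_extension; apply: preserves_cospans_tcomp.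
by move=> X Y phi; apply: bar_tcomp.
Qed.
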